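(* Let $S^m\subset\mathbb{R}^{m+1}$ ($m\ge1$) be the unit sphere with its standard metric, let $\mathbb{N}=\{0,1,2,\dots\}$, and put $\lambda_k=k(m+k-1)$ for $k\in\mathbb{N}$. (I) All eigenvalues of the bi-Laplacian on $S^m$ are squares of eigenvalues of the Laplacian, and bi-eigenfunctions on $S^m$ are precisely the restrictions of harmonic homogeneous polynomials on $\mathbb{R}^{m+1}$; that is, $$\mathrm{Spec}_{\Delta^2}(S^m)=\{\lambda_k^2 \;:\; k\in\mathbb{N}\},\qquad V^2(\lambda_k^2)=\{h|_{S^m} : h\in\mathcal{H}^k\}\quad\text{for all }k\in\mathbb{N}.$$ In particular, the first nonzero eigenvalue of the bi-Laplacian on $S^m$ is $m^2$. (II) The set of all buckling eigenvalues on $S^m$ is the same as the set of all eigenvalues of the Laplacian on $S^m$, and buckling eigenfunctions are precisely the restrictions of polynomials of the form $h_k+c|x|^2$ with $h_k\in\mathcal{H}^k$ and $c\in\mathbb{R}$; that is, $$\mathrm{Spec}_{\Delta^b}(S^m)=\mathrm{Spec}_{\Delta}(S^m)=\{\lambda_k \;:\; k\in\mathbb{N}\},\qquad V^b(\lambda_k)=\{(h+c|x|^2)|_{S^m} : h\in\mathcal{H}^k,\ c\in\mathbb{R}\}\quad\text{for all }k\in\mathbb{N}.$$ In particular, the first nonzero buckling eigenvalue of $S^m$ is $m$.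
   Context: All functions are real-valued. $\Delta f=\operatorname{div}(\nabla f)$ and $\Delta^2f=\Delta(\Delta f)$. $\mathcal{H}^k$ is the space of harmonic homogeneous polynomials of degree $k$ on $\mathbb{R}^{m+1}$ (including $0$). For a closed Riemannian manifold $M$: - $\mathrm{Spec}_\Delta(M)$ is the set of $\lambda\in\mathbb{R}$ for which there is a nonzero $f\in C^\infty(M)$ with $\Delta f=-\lambda f$. - $\mathrm{Spec}_{\Delta^2}(M)$ (bi-eigenvalues) is the set of $\mu\in\mathbb{R}$ for which there is a nonzero $f\in C^\infty(M)$ with $\Delta^2 f=\mu f$ (such an $f$ is a bi-eigenfunction), and $V^2(\mu)=\{f\in C^\infty(M) : \Delta^2 f=\mu f\}$. - A buckling eigenfunction with buckling eigenvalue $\nu$ is a solution $f\in C^\infty(M)$ of $\Delta^2 f=-\nu\Delta f$; $V^b(\nu)=\{f\in C^\infty(M) : \Delta^2 f=-\nu\Delta f\}$. The set $\mathrm{Spec}_{\Delta^b}(M)$ of buckling eigenvalues consists of the trivial buckling eigenvalue $\nu_0=0$ (with constant functions as eigenfunctions) together with all $\nu\in\mathbb{R}$ for which $\Delta^2 f=-\nu\Delta f$ has a nonconstant solution $f\in C^\infty(M)$. *)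

(* Defs.v *)
From HB Require Import structures.
From mathcomp Require Import all_boot all_order all_algebra.
From mathcomp Require Import all_classical all_reals all_analysis.
(* The notations of mpoly clash with those of the analysis library. *)
From mathcomp Require mpoly.
Import -(notations) mpoly.

Set Implicit Arguments.
Unset Strict Implicit.
Unset Printing Implicit Defensive.

Import Order.TTheory GRing.Theory Num.Theory.
Import numFieldNormedType.Exports.

Local Open Scope classical_set_scope.
Local Open Scope ring_scope.

Section Euclidean.
Variables (R : realType) (n : nat).
Implicit Types (x y : 'rV[R]_n) (U : set 'rV[R]_n) (F : 'rV[R]_n -> R).

(* The library norm on 'rV[R]_n is the sup norm. It gives the usual topology
   and the usual derivatives, but not the Euclidean length. *)
Definition dot x y : R := \sum_(i < n) x 0 i * y 0 i.

Definition enorm x : R := Num.sqrt (dot x x).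

Definition evec (i : 'I_n) : 'rV[R]_n := delta_mx 0 i.

Fixpoint Ck_on (k : nat) U F : Prop :=
  (forall x, U x -> {for x, continuous F}) /\
  if k is k'.+1 then
    forall i : 'I_n,
      (forall x, U x -> derivable F x (evec i)) /\
      Ck_on k' U (fun x => 'D_(evec i) F x)
  else True.

Definition smooth_on U F : Prop := forall k, Ck_on k U F.

End Euclidean.

Section Sphere.
Variables (R : realType) (m : nat).

Definition usphere := {x : 'rV[R]_m.+1 | dot x x == 1}.

Lemma pole_subproof : dot (evec R (ord0 : 'I_m.+1)) (evec R ord0) == 1.
Proof.
rewrite /dot /evec (bigD1 ord0) //= big1 ?addr0 => [|i i0].
  by rewrite !mxE !eqxx mulr1.
by rewrite !mxE (negPf i0) andbF mulr0.
Qed.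

Definition pole : usphere := exist _ (evec R ord0) pole_subproof.

(* x / |x|, with an arbitrary value at x = 0 *)
Definition retract (x : 'rV[R]_m.+1) : usphere :=
  insubd pole ((enorm x)^-1 *: x).

(* A smooth function on a subset of Euclidean space is one that extends, near
   each point of the subset, to a smooth function on an open set. *)
Definition smooth_sphere : set (usphere -> R) :=
  [set f | forall p : usphere,
     exists (U : set 'rV[R]_m.+1) (F : 'rV[R]_m.+1 -> R),
       [/\ open U, U (val p), smooth_on U F &
           forall q : usphere, U (val q) -> F (val q) = f q]].

(* For v tangent to the sphere at p this is the derivative at t = 0 of g along
   the curve t |-> (p + t v) / |p + t v| of the sphere, whose velocity at t = 0
   is v. *)
Definition sdiff (V : normedModType R) (g : usphere -> V) (p : usphere)
    (v : 'rV[R]_m.+1) : V :=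
  'D_v (g \o retract) (val p).

(* orthogonal projection of R^(m+1) onto the tangent space at p *)
Definition tproj (p : usphere) (v : 'rV[R]_m.+1) : 'rV[R]_m.+1 :=
  v - dot v (val p) *: val p.

(* The tangent vector at p representing the differential of f at p for the
   metric induced by dot: its scalar product with v is
   sdiff f p (tproj p v). *)
Definition sgrad (f : usphere -> R) (p : usphere) : 'rV[R]_m.+1 :=
  \row_i sdiff f p (tproj p (evec R i)).

(* Levi-Civita connection of the induced metric: the tangential part of the
   derivative, taken in R^(m+1), of the tangent vector field X along v. *)
Definition scov (X : usphere -> 'rV[R]_m.+1) (p : usphere)
    (v : 'rV[R]_m.+1) : 'rV[R]_m.+1 :=
  tproj p (sdiff X p v).

(* Trace of v |-> scov X p v on the tangent space at p, computed on R^(m+1)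
   after extending this endomorphism by 0 to the normal line. *)
Definition sdiv (X : usphere -> 'rV[R]_m.+1) (p : usphere) : R :=
  \sum_(i < m.+1) dot (scov X p (tproj p (evec R i))) (evec R i).

Definition slap (f : usphere -> R) : usphere -> R := sdiv (sgrad f).

Definition bilap (f : usphere -> R) : usphere -> R := slap (slap f).

Definition lap_spectrum : set R :=
  [set l | exists f, [/\ smooth_sphere f, f <> cst 0 &
                         slap f = (fun p => - l * f p)]].

Definition bilap_space (mu : R) : set (usphere -> R) :=
  [set f | smooth_sphere f /\ bilap f = (fun p => mu * f p)].

Definition bilap_spectrum : set R :=
  [set mu | exists f, bilap_space mu f /\ f <> cst 0].

Definition buckling_space (nu : R) : set (usphere -> R) :=
  [set f | smooth_sphere f /\ bilap f = (fun p => - nu * slap f p)].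

Definition buckling_spectrum : set R :=
  0 |` [set nu | exists f, buckling_space nu f /\ ~ exists c, f = cst c].

Definition harmonic (h : mpoly m.+1 R) : Prop :=
  \sum_(i < m.+1) mderiv i (mderiv i h) = 0.

(* The predicate ishomog1 holds of the zero polynomial for every degree. *)
Definition harm_poly (k : nat) : set (mpoly m.+1 R) :=
  [set h | h \is ishomog1 k (@mdeg m.+1) /\ harmonic h].

Definition sqnorm_poly : mpoly m.+1 R :=
  \sum_(i < m.+1) mpolyX R (mnm1 i) ^+ 2.

Definition restrict_sphere (h : mpoly m.+1 R) : usphere -> R :=
  fun p => meval (fun i => val p 0 i) h.

Definition lambda (k : nat) : R := k%:R * (m%:R + k%:R - 1).

End Sphere.

Arguments lap_spectrum : clear implicits.
Arguments bilap_spectrum : clear implicits.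
Arguments buckling_spectrum : clear implicits.
Arguments bilap_space : clear implicits.
Arguments buckling_space : clear implicits.
Arguments harm_poly : clear implicits.
Arguments sqnorm_poly : clear implicits.
Arguments lambda : clear implicits.

Definition first_nonzero (R : realType) (S : set R) (a : R) : Prop :=
  [/\ S a, a != 0 & forall b, S b -> b != 0 -> a <= b].

(* Main.v *)
Require Import Defs.
From HB Require Import structures.
From mathcomp Require Import all_boot all_order all_algebra.
From mathcomp Require Import all_classical all_reals all_analysis.
From mathcomp Require mpoly.
Import -(notations) mpoly.
From mathcomp Require Import ring lra zify.
From mathcomp Require finmap.

Set Implicit Arguments.
Unset Strict Implicit.
Unset Printing Implicit Defensive.

Import Order.TTheory GRing.Theory Num.Theory.
Import numFieldNormedType.Exports.

Local Open Scope classical_set_scope.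
Local Open Scope ring_scope.

(** No integration is needed: everything rests on the maximum principle (the Laplacian of a
    function is nonpositive at its maximum). Let lam_k = k(m+k-1), and let H^k be the restrictions
    of the harmonic homogeneous polynomials of degree k, on which the Laplacian is multiplication by
    - lam_k. Every polynomial on the sphere is a finite sum q = h_0 + h_1 + ... with h_k in H^k, and
    q - h_0 is the Laplacian of - sum_(k > 0) h_k / lam_k; at the extrema of the latter this gives
    min q <= h_0 <= max q. As polynomials are uniformly dense (Weierstrass), q |-> h_0 extends to a
    positive linear functional on the continuous functions, the mean.
    - The mean vanishes on Laplacians. Applied to a product hg with h in H^j and g in H^k, where
      Lap (hg) = 2 sum_i (d_i h) (d_i g) - lam_(j+k) hg on the sphere, this proves by induction that
      H^j and H^k are orthogonal for j <> k.
    - Since |u| <= max |Lap u - u|, a smooth f can be approximated by polynomials v so that Lap v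
      approximates Lap f too; so mean ((Lap f) h) = - lam_k mean (f h) for h in H^k.
    - The mean is strictly positive, because the moments of a linear form x.r, given by an explicit
      recurrence, decay more slowly than any geometric sequence of ratio < 1.
    So if f solves one of the eigenvalue equations, then f is orthogonal to H^j for every j outside
    an explicit set of at most two degrees, and it equals its projection on the remaining ones. *)

(** * Functions with continuous partial derivatives *)

Lemma is_derive_line (R : realType) (V W : normedModType R) (F : V -> W) (a v : V) (t : R) :
  derivable F (a + t *: v) v ->
  is_derive t 1 (fun s => F (a + s *: v)) ('D_v F (a + t *: v)).
Proof.
move=> dF.
have E : (fun h : R => h^-1 *: (((fun s => F (a + s *: v)) \o shift t) (h *: (1:R)) -
      F (a + t *: v))) =
  (fun h : R => h^-1 *: ((F \o shift (a + t *: v)) (h *: v) - F (a + t *: v))).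
  apply/funext => h /=; congr (_ *: (F _ - _)).
  by rewrite [h *: 1]mulr1 scalerDl addrCA.
split; first by rewrite /derivable E.
by rewrite /derive E.
Qed.

(** The mean value theorem along a line, used on [[0, c]] or on [[c, 0]] according to the sign of
    [c]. *)
Lemma norm_line_increment_le (R : realType) (V : normedModType R) (F : V -> R)
    (a v : V) (c A e : R) :
  (forall t : R, `|t| <= `|c| -> derivable F (a + t *: v) v) ->
  (forall t : R, `|t| <= `|c| -> `|'D_v F (a + t *: v) - A| <= e) ->
  `|F (a + c *: v) - F a - c * A| <= e * `|c|.
Proof.
move=> dF De.
pose g (t : R) := F (a + t *: v); pose dg (t : R) : R := 'D_v F (a + t *: v).
have gd (t : R) : `|t| <= `|c| -> is_derive t 1 g (dg t).
  by move=> tc; apply: is_derive_line; exact: dF.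
have key x y : x <= y -> (forall t, t \in `[x, y] -> `|t| <= `|c|) ->
    `|g y - g x - (y - x) * A| <= e * `|y - x|.
  move=> xy xyc.
  have [||t /xyc tc ->] := @MVT_segment _ g dg _ _ xy.
  - by move=> t txy; apply: gd; apply: xyc; apply: subset_itv_oo_cc txy.
  - apply: derivable_within_continuous => t txy.
    by have [] := gd t (xyc _ txy).
  by rewrite [dg t * _]mulrC -mulrBr normrM mulrC ler_wpM2r// De.
have g0 : g 0 = F a by rewrite /g scale0r addr0.
have [c0|/ltW c0] := leP 0 c.
  have := key 0 c c0; rewrite g0 subr0; apply => t.
  by rewrite in_itv/= => /andP[? ?]; rewrite !ger0_norm.
have := key c 0 c0; rewrite g0 sub0r normrN => H.
rewrite -normrN; apply: le_trans (H _) => [|t].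
  by rewrite le_eqVlt -/(g c); apply/orP; left; apply/eqP; congr `|_|; ring.
by rewrite in_itv/= => /andP[? ?]; rewrite !ler0_norm// lerN2.
Qed.

Lemma differentiable_of_error (R : realType) (V W : normedModType R) (F : V -> W)
    (L : {linear V -> W}) (x : V) :
  continuous L ->
  (forall e : R, 0 < e -> \forall h \near nbhs (0 : V), `|F (x + h) - F x - L h| <= e * `|h|) ->
  differentiable F x /\ 'd F x = L :> (V -> W).
Proof.
move=> cL FL.
have E : F \o shift x = cst (F x) + L +o_ 0 id.
  apply/eqaddoP => _/posnumP[e].
  apply: filterS (FL e%:num _) => // h.
  rewrite -![(_ + _ : _ -> _) _]/(_ + _) -![(- _ : _ -> _) _]/(- _) opprD addrA.
  by rewrite /= [h + x]addrC.
have D := diff_unique cL E.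
by split=> //; apply/diff_locallyP; rewrite D; split.
Qed.

Section partials.
Variables (R : realType) (n : nat).
Implicit Types (x h : 'rV[R]_n) (F : 'rV[R]_n -> R).

(** The linear map that should be the differential when the partial derivatives are [a]; [R^o] is
    [R] seen as a module over itself, as linear maps require. *)
Definition lincomb (a : 'I_n -> R) h : R^o := \sum_i h 0 i * a i.

Lemma lincomb_is_linear a : linear (lincomb a).
Proof.
move=> c u v; rewrite /lincomb scaler_sumr -big_split/=; apply: eq_bigr => i _.
by rewrite !mxE mulrDl -mulrA.
Qed.

HB.instance Definition _ a :=
  GRing.isLinear.Build R 'rV[R]_n R^o _ (lincomb a) (lincomb_is_linear a).

Lemma ler_norm_coord h i : `|h 0 i| <= `|h|.
Proof.
rewrite [leRHS]/Num.Def.normr/= mx_normrE.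
exact: (le_bigmax _ (fun ij => `|h ij.1 ij.2|) (0, i)).
Qed.

Lemma lincomb_continuous a : continuous (lincomb a).
Proof.
apply: bounded_linear_continuous.
exists (\sum_i `|a i|); split; first exact: num_real.
move=> M aM; near=> h.
rewrite /= (le_trans (ler_norm_sum _ _ _))//; apply: le_trans (ltW aM).
apply: ler_sum => i _; rewrite normrM ler_piMl//.
apply: le_trans (ler_norm_coord _ _) _.
by near: h; exact: (@nbhs0_le _ 'rV[R]_n 1 ltr01).
Unshelve. all: by end_near. Qed.

(** The vertices of the path from 0 to [h] that switches on one coordinate at a time. *)
Definition trunc (k : nat) h : 'rV[R]_n := \row_i (if (i < k)%N then h 0 i else 0).

Lemma truncS (i : 'I_n) h : trunc i.+1 h = trunc i h + h 0 i *: evec R i.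
Proof.
apply/rowP => j; rewrite !mxE ltnS leq_eqVlt eqxx/=.
case: (eqVneq j i) => [->|ji]; first by rewrite eqxx ltnn mulr1 add0r.
by rewrite (negPf (_ : val j != val i)) //= mulr0 addr0.
Qed.

(** For the sup norm the whole path stays in the closed ball of radius [|h|]. *)
Lemma norm_trunc_line (i : 'I_n) h t : `|t| <= `|h 0 i| -> `|trunc i h + t *: evec R i| <= `|h|.
Proof.
move=> th; rewrite [leLHS]/Num.Def.normr/= mx_normrE bigmax_le//= => -[j0 j] _ /=.
rewrite ord1 !mxE eqxx /=; case: (eqVneq j i) => [->|ji].
  by rewrite ltnn add0r mulr1 (le_trans th)// ler_norm_coord.
rewrite mulr0 addr0; case: ifP => _; first exact: ler_norm_coord.
by rewrite normr0.
Qed.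

(** The increment of [F] telescopes along the path of the [trunc k h]; on each segment only one
    coordinate moves, and the mean value estimate compares the increment with the partial derivative
    at [x]. *)
Lemma differentiable_partials F x :
  (\forall y \near x, forall i, derivable F y (evec R i)) ->
  (forall i, {for x, continuous (fun y => 'D_(evec R i) F y)}) ->
  differentiable F x /\ forall v, 'D_v F x = lincomb (fun i => 'D_(evec R i) F x) v.
Proof.
move=> dF cF; set a := fun i => _.
have L (e : R) : 0 < e -> \forall h \near nbhs (0 : 'rV[R]_n),
    `|F (x + h) - F x - lincomb a h| <= e * `|h|.
  move=> e0.
  (* There are [n] segments; dividing by [n.+1] keeps their total below [e] and also makes sense for
     [n = 0]. *)
  have n0 : 0 < e / n.+1%:R by rewrite divr_gt0.
  have : \forall y \near x, forall i, `|'D_(evec R i) F y - a i| <= e / n.+1%:R.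
    apply: (filter_forall (F := nbhs x)) => i.
    have /cvgrPdist_le /(_ _ n0) := cF i.
    by apply: filterS => y; rewrite distrC.
  move=> cF'; have [d /= d0 dP] := (iffLR (nbhs_normP _ _)) (filterI dF cF').
  near=> h.
  have hd : `|h| < d.
    by near: h; exact: (@nbhs0_lt _ 'rV[R]_n).
  have step (i : 'I_n) : `|F (x + trunc i.+1 h) - F (x + trunc i h) - h 0 i * a i| <=
      e / n.+1%:R * `|h|.
    have P t : `|t| <= `|h 0 i| -> ball_ Num.norm x d (x + trunc i h + t *: evec R i).
      move=> /norm_trunc_line thd.
      by rewrite /ball_/= -addrA opprD addrA subrr sub0r normrN (le_lt_trans thd).
    rewrite truncS addrA.
    have d1 t : `|t| <= `|h 0 i| -> derivable F (x + trunc i h + t *: evec R i) (evec R i).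
      by move=> /P /dP [F1 _]; exact: F1.
    have d2 t : `|t| <= `|h 0 i| ->
        `|'D_(evec R i) F (x + trunc i h + t *: evec R i) - a i| <= e / n.+1%:R.
      by move=> /P /dP [_ F2]; exact: F2.
    apply: le_trans (norm_line_increment_le d1 d2) _.
    by rewrite ler_wpM2l// ?ler_norm_coord// ltW.
  have -> : F (x + h) = F (x + trunc n h).
    by congr (F (_ + _)); apply/rowP => i; rewrite mxE ltn_ord.
  have -> : F (x + trunc n h) - F x - lincomb a h =
     \sum_(i < n) (F (x + trunc i.+1 h) - F (x + trunc i h) - h 0 i * a i).
    rewrite big_split/= sumrN -[\sum_(i < n) h 0 i * a i]/(lincomb a h).
    rewrite -(big_mkord xpredT (fun i => F (x + trunc i.+1 h) - F (x + trunc i h))).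
    rewrite telescope_sumr//; congr (_ - F _ - _).
    by rewrite (_ : trunc 0 h = 0) ?addr0//; apply/rowP => i; rewrite !mxE.
  apply: le_trans (ler_norm_sum _ _ _) _.
  apply: le_trans (ler_sum _ (fun i _ => step i)) _.
  rewrite sumr_const card_ord -[_ *+ n]mulr_natl mulrA ler_wpM2r//.
  by rewrite mulrCA ler_piMr// ?(ltW e0)// ler_pdivrMr// mul1r ler_nat.
have [D DE] := @differentiable_of_error _ 'rV[R]_n R^o F (lincomb a) x
  (@lincomb_continuous a) L.
by split=> // v; rewrite deriveE// DE.
Unshelve. all: by end_near. Qed.

End partials.

(** * Functions of class C^k *)

Section Ck.
Variables (R : realType) (n : nat).
Implicit Types (x h : 'rV[R]_n) (F G : 'rV[R]_n -> R) (U V : set 'rV[R]_n).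

Lemma Ck_on_cont k U F x : Ck_on k U F -> U x -> {for x, continuous F}.
Proof. by case: k => [|k] [cF _]; exact: cF. Qed.

Lemma Ck_on_derivable k U F i x :
  Ck_on k.+1 U F -> U x -> derivable F x (evec R i).
Proof. by move=> [_ /(_ i)[dF _]]; exact: dF. Qed.

Lemma Ck_on_derive k U F i : Ck_on k.+1 U F -> Ck_on k U (fun x => 'D_(evec R i) F x).
Proof. by move=> [_ /(_ i)[]]. Qed.

Lemma Ck_onW k U F : Ck_on k.+1 U F -> Ck_on k U F.
Proof.
elim: k F => [|k IH] F [cF dF]; split=> // i.
by have [? /IH] := dF i.
Qed.

Lemma Ck_on_subset k U V F : V `<=` U -> Ck_on k U F -> Ck_on k V F.
Proof.
move=> VU; elim: k F => [|k IH] F [cF dF]; (split; first by move=> x /VU /cF) => // i.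
by have [d1 /IH d2] := dF i; split=> // x /VU; exact: d1.
Qed.

Lemma Ck_on_local k U F :
  (forall x, U x -> exists2 V, V x & Ck_on k V F) -> Ck_on k U F.
Proof.
elim: k F => [|k IH] F H; (split; first by move=> x /H[V Vx /Ck_on_cont]; exact) => // i.
split=> [x /H[V Vx /Ck_on_derivable]|]; first exact.
by apply: IH => x /H[V Vx FV]; exists V => //; exact: Ck_on_derive.
Qed.

Lemma near_eq_continuous F G x :
  (\forall y \near x, F y = G y) -> {for x, continuous F} -> {for x, continuous G}.
Proof.
move=> FG cF; rewrite /prop_for /continuous_at -(nbhs_singleton FG).
by apply: cvg_trans cF; apply: (near_eq_cvg (F := nbhs x)).
Qed.

(** On an open set equality of two functions is equality near each point, so it passes to all
    derivatives. *)
Lemma Ck_on_eq k U F G : open U -> {in U, F =1 G} -> Ck_on k U F -> Ck_on k U G.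
Proof.
move=> oU; elim: k F G => [|k IH] F G FG CF.
all: have nFG x : U x -> \forall y \near x, F y = G y.
1,3: by move=> Ux; apply: filterS (open_nbhs_nbhs (conj oU Ux)) => y Uy; apply: FG; rewrite inE.
all: have cG x : U x -> {for x, continuous G}.
1,3: by move=> Ux; apply: near_eq_continuous (nFG x Ux) (Ck_on_cont CF Ux).
all: split=> // i; split=> [x Ux|].
  by apply: near_eq_derivable (nFG _ Ux) _; exact: Ck_on_derivable CF Ux.
apply: IH (Ck_on_derive i CF) => x; rewrite inE => Ux.
by apply: near_eq_derive; exact: nFG.
Qed.

Lemma Ck_on_cst k U (c : R) : Ck_on k U (cst c).
Proof.
elim: k c => [|k IH] c; (split; first by move=> x _; exact: cst_continuous) => // i.
split=> [x _|]; first exact: derivable_cst.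
rewrite (_ : (fun x => _) = cst 0); first exact: IH.
by apply/funext => x; rewrite derive_cst.
Qed.

Lemma is_derive_coord i x v : is_derive x v (fun y : 'rV[R]_n => y 0 i : R) (v 0 i).
Proof.
have d : derivable (fun y : 'rV[R]_n => y) x v by exact: derivable_id.
split; first exact: (iffLR (derivable_mxP _ _ _) d).
have /rowP/(_ i) := derive_mx d.
by rewrite derive_id !mxE => <-.
Qed.

Lemma Ck_on_coord k U i : Ck_on k U (fun x => x 0 i).
Proof.
case: k => [|k]; (split; first by move=> x _; exact: coord_continuous) => // j.
split=> [x _|]; first by have [] := is_derive_coord i x (evec R j).
rewrite (_ : (fun x => _) = cst (evec R j 0 i)); first exact: Ck_on_cst.
by apply/funext => x; have [_ ->] := is_derive_coord i x (evec R j).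
Qed.

Lemma Ck_onD k U F G : open U -> Ck_on k U F -> Ck_on k U G ->
  Ck_on k U (fun x => F x + G x).
Proof.
move=> oU; elim: k F G => [|k IH] F G CF CG.
all: have cFG x : U x -> {for x, continuous (fun x => F x + G x)}.
1,3: by move=> Ux; exact: (continuousD (Ck_on_cont CF Ux) (Ck_on_cont CG Ux)).
all: split=> // i; split=> [x Ux|].
  by apply: derivableD; [exact: (Ck_on_derivable CF Ux)|exact: (Ck_on_derivable CG Ux)].
apply: Ck_on_eq oU _ (IH _ _ (Ck_on_derive i CF) (Ck_on_derive i CG)) => x.
rewrite inE => Ux; rewrite -deriveD//.
  exact: (Ck_on_derivable CF Ux).
exact: (Ck_on_derivable CG Ux).
Qed.

Lemma Ck_onM k U F G : open U -> Ck_on k U F -> Ck_on k U G ->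
  Ck_on k U (fun x => F x * G x).
Proof.
move=> oU; elim: k F G => [|k IH] F G CF CG.
all: have cFG x : U x -> {for x, continuous (fun x => F x * G x)}.
1,3: by move=> Ux; exact: (continuousM (Ck_on_cont CF Ux) (Ck_on_cont CG Ux)).
all: split=> // i; split=> [x Ux|].
  by apply: derivableM; [exact: (Ck_on_derivable CF Ux)|exact: (Ck_on_derivable CG Ux)].
have C1 := IH _ _ (Ck_onW CF) (Ck_on_derive i CG).
have C2 := IH _ _ (Ck_onW CG) (Ck_on_derive i CF).
apply: Ck_on_eq oU _ (Ck_onD oU C1 C2) => x.
rewrite inE => Ux; rewrite deriveM//.
  exact: (Ck_on_derivable CF Ux).
exact: (Ck_on_derivable CG Ux).
Qed.

Lemma Ck_onX k U F d : open U -> Ck_on k U F -> Ck_on k U (fun x => F x ^+ d).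
Proof.
move=> oU CF; elim: d => [|d IH].
  by rewrite (_ : (fun x => _) = cst 1)//; exact: Ck_on_cst.
rewrite (_ : (fun x => _) = (fun x => F x * F x ^+ d)); first exact: Ck_onM.
by apply/funext => x; rewrite exprS.
Qed.

Lemma Ck_on_sum k U (I : Type) (r : seq I) (F : I -> 'rV[R]_n -> R) : open U ->
  (forall i, Ck_on k U (F i)) -> Ck_on k U (fun x => \sum_(i <- r) F i x).
Proof.
move=> oU CF; elim: r => [|a r IH].
  rewrite (_ : (fun x => _) = cst 0); first exact: Ck_on_cst.
  by apply/funext => x; rewrite big_nil.
rewrite (_ : (fun x => _) = (fun x => F a x + \sum_(i <- r) F i x)); first exact: Ck_onD.
by apply/funext => x; rewrite big_cons.
Qed.

Lemma Ck_on_differentiable k U F x : open U -> Ck_on k.+1 U F -> U x ->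
  differentiable F x /\ forall v, 'D_v F x = lincomb (fun i => 'D_(evec R i) F x) v.
Proof.
move=> oU CF Ux; apply: differentiable_partials => [|i].
  by apply: filterS (open_nbhs_nbhs (conj oU Ux)) => y Uy i; exact: (Ck_on_derivable CF Uy).
exact: (Ck_on_cont (Ck_on_derive i CF) Ux).
Qed.

End Ck.

(** * Chain rule and composition *)

Section Ck_comp.
Variables (R : realType) (n p : nat).

Lemma rV_continuous_coord (T : topologicalType) (phi : T -> 'rV[R]_p) (x : T) :
  (forall j, {for x, continuous (fun y => phi y 0 j)}) -> {for x, continuous phi}.
Proof.
move=> H; apply/(@cvgrPdist_lt _ 'rV[R]_p) => e e0; near=> y.
rewrite [ltLHS]/Num.Def.normr/= mx_normrE bigmax_lt//= => -[i j] _ /=.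
rewrite ord1 !mxE; move: j; near: y; apply: filter_forall => j.
by have /cvgrPdist_lt/(_ _ e0) := H j.
Unshelve. all: by end_near. Qed.

Lemma differentiable_row (phi : 'rV[R]_n -> 'rV[R]_p) x :
  (forall j, differentiable (fun y => phi y 0 j : R) x) -> differentiable phi x.
Proof.
move=> H.
have -> : phi = \sum_(j < p) (fun y => (phi y 0 j : R) *: evec R j).
  apply/funext => y; rewrite fct_sumE; apply/rowP => j.
  rewrite summxE (bigD1 j)//= big1 ?addr0 => [|i ij]; rewrite !mxE ?eqxx ?mulr1//.
  by rewrite eq_sym (negPf ij) andbF mulr0.
apply: differentiable_sum => j.
by apply: differentiableZl; exact: H.
Qed.

Lemma derive_chain (F : 'rV[R]_p -> R) (phi : 'rV[R]_n -> 'rV[R]_p) x v :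
  differentiable F (phi x) -> (forall j, differentiable (fun y => phi y 0 j : R) x) ->
  derivable (F \o phi) x v /\
  'D_v (F \o phi) x = 'D_(\row_j 'D_v (fun y => phi y 0 j : R) x) F (phi x).
Proof.
move=> dF dphi; have dp := differentiable_row dphi.
have dc : differentiable (F \o phi) x by exact: differentiable_comp.
split; first exact: diff_derivable.
rewrite [LHS]deriveE// diff_comp//= [RHS]deriveE//; congr ('d F (phi x) _).
rewrite -(deriveE _ dp); rewrite derive_mx; last exact: diff_derivable.
by apply/matrixP => i j; rewrite !mxE ord1.
Qed.

(** By the chain rule the partial derivatives of the composite are sums of products of functions of
    class one less, so the induction on [k] closes. *)
Lemma Ck_on_comp k U V (F : 'rV[R]_p -> R) (phi : 'rV[R]_n -> 'rV[R]_p) :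
  open U -> open V -> (forall x, U x -> V (phi x)) ->
  (forall j, Ck_on k U (fun x => phi x 0 j)) -> Ck_on k V F -> Ck_on k U (F \o phi).
Proof.
move=> oU oV UV; elim: k F => [|k IH] F Cp CF.
all: have cFG x : U x -> {for x, continuous (F \o phi)}.
1,3: move=> Ux; apply: continuous_comp; last exact: (Ck_on_cont CF (UV _ Ux)).
1,2: by apply: rV_continuous_coord => j; exact: (Ck_on_cont (Cp j) Ux).
all: split=> // i.
have H x : U x -> derivable (F \o phi) x (evec R i) /\
   'D_(evec R i) (F \o phi) x =
   \sum_j 'D_(evec R i) (fun y => phi y 0 j : R) x * 'D_(evec R j) F (phi x).
  move=> Ux; have [dF DF] := Ck_on_differentiable oV CF (UV _ Ux).
  have [||d ->] := @derive_chain F phi x (evec R i) => //.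
    by move=> j; have [] := Ck_on_differentiable oU (Cp j) Ux.
  by split=> //; rewrite DF /lincomb; apply: eq_bigr => j _; rewrite mxE.
split=> [x /H[]//|].
apply: (Ck_on_eq oU (F := fun x => \sum_j
  'D_(evec R i) (fun y => phi y 0 j : R) x * 'D_(evec R j) F (phi x))).
  by move=> x; rewrite inE => /H[_ ->].
apply: Ck_on_sum => // j; apply: Ck_onM => //; first exact: Ck_on_derive (Cp j).
by apply: (IH (fun y => 'D_(evec R j) F y)); [move=> l; exact: Ck_onW|exact: Ck_on_derive].
Qed.

End Ck_comp.

(** * The Laplacian on the sphere *)

(** If [A] were positive, [dg 0 = 0] would make [dg] positive just to the right of 0, and the mean
    value theorem would give a value of [g] above the maximum. *)
Lemma second_derivative_at_max (R : realType) (g dg : R -> R) (d A : R) :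
  0 < d -> (forall t : R, `|t| < d -> is_derive t (1 : R) g (dg t)) ->
  is_derive (0 : R) (1 : R) dg A -> (forall t : R, `|t| < d -> g t <= g 0) -> A <= 0.
Proof.
move=> d0 gd [dA DA] gmax.
have dg0 : dg 0 = 0.
  have [_ <-] := gd 0 ltac:(by rewrite normr0).
  have M : is_derive (0 : R) (1 : R) g 0.
    apply: (@derive1_at_max _ g (- d) d).
    - by rewrite ge0_cp// ltW.
    - by move=> t; rewrite in_itv/= -ltr_norml => /gd[].
    - by rewrite in_itv/= oppr_lt0 d0.
    - by move=> t; rewrite in_itv/= -ltr_norml => /gmax.
  by have [_ ->] := M.
rewrite leNgt; apply/negP => A0.
have A2 : 0 < A / 2 by rewrite divr_gt0.
have /cvgrPdist_lt/(_ _ A2) : h^-1 *: ((dg \o shift 0) (h *: (1:R)) - dg 0) @[h --> 0^'] --> A.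
  by rewrite -DA; exact: dA.
rewrite /dnbhs near_withinE => /nbhs_norm0P[e /= e0 He].
(* Small enough both for [dg] to be the derivative of [g] (radius [d]) and for the difference
   quotient of [dg] to be within [A / 2] of its limit (radius [e]). *)
pose c := Num.min d e / 2.
have c0 : 0 < c by rewrite divr_gt0// lt_min d0.
have cd : c < d by rewrite ltr_pdivrMr// gt_min; apply/orP; left; rewrite ltr_pMr// ltr1n.
have ce : c < e by rewrite ltr_pdivrMr// gt_min; apply/orP; right; rewrite ltr_pMr// ltr1n.
have [||t tc] := @MVT _ g dg _ _ c0.
- move=> t; rewrite in_itv/= => /andP[t0 tc]; apply: gd.
  by rewrite ger0_norm ?ltW// (lt_trans tc).
- apply: derivable_within_continuous => t; rewrite in_itv/= => /andP[t0 tc].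
  by have [] := gd t ltac:(by rewrite ger0_norm// (le_lt_trans tc)).
move: tc; rewrite in_itv/= => /andP[t0 tc] E.
have te : `|t| < e by rewrite ger0_norm ?ltW// (lt_trans tc).
have tN0 : t != 0 by rewrite gt_eqF.
have := He t te tN0; rewrite /= dg0 addr0 subr0 [t *: 1]mulr1 => Ht.
have dgt : 0 < dg t.
  suff : 0 < t^-1 *: dg t by rewrite [t^-1 *: _]/(t^-1 * _) pmulr_rgt0// invr_gt0.
  move: Ht; set z := t^-1 *: dg t; rewrite ltr_norml => /andP[_]; lra.
have := gmax c ltac:(by rewrite ger0_norm ?ltW).
by rewrite -subr_le0 E subr0 leNgt mulr_gt0.
Qed.

Lemma is_derive_comp1 (R : realType) (V : normedModType R) (f : R -> R) (g : V -> R)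
    (x v : V) (df dg : R) :
  differentiable g x -> is_derive x v g dg -> is_derive (g x) (1 : R) f df ->
  is_derive x v (f \o g) (df * dg).
Proof.
move=> dG [_ <-] [dF <-]; have dF' : differentiable f (g x) by apply/derivable1_diffP.
have dc : differentiable (f \o g) x by exact: differentiable_comp.
split; first exact: diff_derivable.
rewrite [LHS]deriveE// diff_comp//= -derive1E derive1E'// [in RHS]deriveE//.
by rewrite -[in LHS](mulr1 ('d g x v)) linearZ mulrC.
Qed.

(** * The scalar product and the function 1/|x| *)

Section dot.
Variables (R : realType) (n : nat).
Implicit Types x y : 'rV[R]_n.

Lemma dot_ge0 x : 0 <= dot x x.
Proof. by apply: sumr_ge0 => i _; rewrite -expr2 sqr_ge0. Qed.

Lemma dot_eq0 x : dot x x = 0 -> x = 0.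
Proof.
move=> /eqP; rewrite psumr_eq0 => [/allP H|i _]; last by rewrite -expr2 sqr_ge0.
apply/rowP => i; rewrite mxE; apply/eqP.
by have := H i (mem_index_enum _); rewrite /= -expr2 sqrf_eq0.
Qed.

Lemma dotC x y : dot x y = dot y x.
Proof. by apply: eq_bigr => i _; rewrite mulrC. Qed.

Lemma dotZl (c : R) x y : dot (c *: x) y = c * dot x y.
Proof. by rewrite /dot mulr_sumr; apply: eq_bigr => i _; rewrite mxE mulrA. Qed.

Lemma dotDl x y z : dot (x + y) z = dot x z + dot y z.
Proof. by rewrite /dot -big_split; apply: eq_bigr => i _; rewrite mxE mulrDl. Qed.

Lemma dotBl x y z : dot (x - y) z = dot x z - dot y z.
Proof. by rewrite dotDl -scaleN1r dotZl mulN1r. Qed.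

Lemma dot_evec x i : dot x (evec R i) = x 0 i.
Proof.
rewrite /dot (bigD1 i)//= big1 => [|j ji]; rewrite !mxE ?eqxx ?mulr1 ?addr0//.
by rewrite (negPf ji) mulr0.
Qed.

Lemma enorm_gt0 x : x != 0 -> 0 < enorm x.
Proof.
move=> x0; rewrite sqrtr_gt0 lt_neqAle dot_ge0 andbT.
by apply: contra_neq x0 => /esym/dot_eq0.
Qed.

Lemma enorm_sqr x : enorm x ^+ 2 = dot x x.
Proof. exact/sqr_sqrtr/dot_ge0. Qed.

Definition rho x : R := (enorm x)^-1.

Lemma rhoE x : rho x = (Num.sqrt (dot x x))^-1. Proof. by []. Qed.

Lemma rho_sqr x : x != 0 -> rho x ^+ 2 * dot x x = 1.
Proof.
by move=> x0; rewrite -enorm_sqr -exprMn mulVf ?expr1n// gt_eqF// enorm_gt0.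
Qed.

Definition punctured : set 'rV[R]_n := [set x | x != 0].

Lemma open_punctured : open punctured.
Proof.
rewrite (_ : punctured = ~` [set 0]); last by apply/seteqP; split => x /= /eqP.
by rewrite openC; apply: accessible_closed_set1; apply: hausdorff_accessible; exact: norm_hausdorff.
Qed.

Lemma Ck_on_dot k U : open U -> Ck_on k U (fun x => dot x x).
Proof.
by move=> oU; apply: Ck_on_sum => // i; apply: Ck_onM => //; exact: Ck_on_coord.
Qed.

Lemma differentiable_dot x : differentiable (fun y => dot y y) x.
Proof.
by have [] := @Ck_on_differentiable _ _ 0 setT _ x openT (Ck_on_dot 1 openT) I.
Qed.

Lemma is_derive_dot x v : is_derive x v (fun y => dot y y : R) (2 * dot v x).
Proof.
have H (i : 'I_n) : is_derive x v (fun y : 'rV[R]_n => (y 0 i * y 0 i : R)) (2 * (v 0 i * x 0 i)).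
  have d := is_derive_coord i x v.
  by apply: is_derive_eq (is_deriveM d d) _; rewrite -![_ *: _]/(_ * _); ring.
rewrite (_ : (fun y => _) = \sum_i (fun y : 'rV[R]_n => (y 0 i * y 0 i : R))).
  by apply: is_derive_eq (is_derive_sum H) _; rewrite /dot mulr_sumr.
by apply/funext => y; rewrite fct_sumE.
Qed.

Lemma is_derive_rho x v : x != 0 -> is_derive x v rho (- dot v x * rho x ^+ 3).
Proof.
move=> x0.
have dx0 : 0 < dot x x by rewrite -enorm_sqr exprn_gt0// enorm_gt0.
have ds : is_derive (dot x x) (1:R) Num.sqrt (2 * Num.sqrt (dot x x))^-1.
  exact: is_derive1_sqrt.
have dd := is_derive_dot x v.
have dG := differentiable_dot x.
have [D1 D2] := is_derive_comp1 dG dd ds.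
have nE : (Num.sqrt \o (fun y => dot y y)) x != 0 by rewrite gt_eqF// enorm_gt0.
split; first exact: derivableV.
rewrite [LHS](deriveV nE D1) D2 /rho -[(Num.sqrt \o _) x]/(enorm x).
rewrite -[Num.sqrt (dot x x)]/(enorm x) -[_ *: _]/(_ * _).
by field; rewrite gt_eqF// enorm_gt0.
Qed.

(** The partial derivatives [- x_i * rho ^+ 3] involve only coordinates and [rho] itself, so
    regularity is bootstrapped. *)
Lemma Ck_on_rho k : Ck_on k punctured rho.
Proof.
have cont x : punctured x -> {for x, continuous rho}.
  move=> x0; have dG := differentiable_dot x.
  have c2 : {for x, continuous (@enorm R n)}.
    apply: (continuous_comp (f := fun y => dot y y) (g := Num.sqrt)).
      exact: differentiable_continuous.
    exact: sqrt_continuous.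
  have e0 : enorm x != 0 by rewrite gt_eqF// enorm_gt0.
  exact: (cvgV e0 c2).
elim: k => [|k IH]; split=> // i; split=> [x x0|].
  by have [] := is_derive_rho (evec R i) x0.
have C : Ck_on k punctured (fun x => (-1) * (x 0 i * rho x ^+ 3)).
  apply: Ck_onM (open_punctured) _ _; first exact: Ck_on_cst.
  by apply: Ck_onM (open_punctured) _ (Ck_onX _ open_punctured IH); exact: Ck_on_coord.
apply: Ck_on_eq open_punctured _ C => x; rewrite inE => x0.
by have [_ ->] := is_derive_rho (evec R i) x0; rewrite dotC dot_evec mulN1r mulNr.
Qed.

End dot.

(** For a unit vector [P] the left side is the trace of [A] compressed to the orthogonal complement
    of [P]. Every correction term is a multiple of the value of [A] at the pair [(P, P)], which is 0
    by [rad]. *)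
Lemma trace_radial (R : realType) (n : nat) (P : 'I_n -> R) (A : 'I_n -> 'I_n -> R) :
  \sum_j P j * (\sum_k P k * A k j) = 0 ->
  \sum_i ((A i i - P i * \sum_k P k * A k i)
    - P i * (\sum_j P j * (A i j - P i * \sum_k P k * A k j))) = \sum_i A i i.
Proof.
move=> rad; rewrite sumrB sumrB rad subr0.
rewrite [X in _ - X](_ : _ = 0) ?subr0//.
pose r j := \sum_k P k * A k j.
transitivity (\sum_i \sum_j (P i * (P j * A i j)) - \sum_i (P i * P i) * \sum_j P j * r j).
  rewrite -sumrB; apply: eq_bigr => i _; rewrite mulr_sumr [in RHS]mulr_sumr -sumrB.
  by apply: eq_bigr => j _; rewrite /r; ring.
rewrite -mulr_suml exchange_big/= rad mulr0 subr0 -[RHS]rad.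
apply: eq_bigr => j _; rewrite mulr_sumr; apply: eq_bigr => i _; ring.
Qed.

(** * The extension constant on rays and the spherical Laplacian *)

Section sphere.
Variables (R : realType) (m : nat).
Implicit Types (x y v : 'rV[R]_m.+1) (p q : usphere R m) (f g : usphere R m -> R).

Local Notation retr := (@retract R m).
Local Notation e_ i := (evec R i).
Local Notation pct := (@punctured R m.+1).

Definition normalize x : 'rV[R]_m.+1 := rho x *: x.

Lemma dot_val p : dot (val p) (val p) = 1.
Proof. exact/eqP/(valP p). Qed.

Lemma val_punctured p : pct (val p).
Proof.
apply/eqP => p0; have := dot_val p; rewrite p0 /dot big1 => [/esym/eqP|i _].
  by rewrite oner_eq0.
by rewrite mxE mul0r.
Qed.

Lemma rho_val p : rho (val p) = 1.
Proof. by rewrite rhoE dot_val sqrtr1 invr1. Qed.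

Lemma val_retract x : pct x -> val (retr x) = normalize x.
Proof.
move=> x0; rewrite val_insubd ifT//.
by rewrite dotZl dotC dotZl mulrA -expr2 rho_sqr.
Qed.

Lemma retractK p : retr (val p) = p.
Proof.
apply: val_inj; rewrite val_retract; last exact: val_punctured.
by rewrite /normalize rho_val scale1r.
Qed.

Lemma retractZ (c : R) x : pct x -> 0 < c -> retr (c *: x) = retr x.
Proof.
move=> x0 c0; have cx0 : pct (c *: x).
  by rewrite /punctured/= scaler_eq0 negb_or gt_eqF.
apply: val_inj; rewrite !val_retract// /normalize scalerA; congr (_ *: _).
rewrite /rho /enorm dotZl dotC dotZl mulrA -expr2 sqrtrM ?sqr_ge0// sqrtr_sqr gtr0_norm//.
by rewrite invfM mulrAC mulVf ?mul1r// gt_eqF.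
Qed.

Lemma Ck_on_normalize k i : Ck_on k pct (fun x => normalize x 0 i).
Proof.
have C := Ck_onM (@open_punctured R m.+1) (@Ck_on_rho R m.+1 k) (Ck_on_coord k _ i).
by apply: (Ck_on_eq (@open_punctured R m.+1) _ C) => x _; rewrite mxE.
Qed.

Lemma normalize_punctured x : pct x -> pct (normalize x).
Proof. by move=> x0; rewrite -val_retract//; exact: val_punctured. Qed.

Lemma normalize_continuous x : pct x -> {for x, continuous normalize}.
Proof.
by move=> x0; apply: rV_continuous_coord => j; exact: (Ck_on_cont (Ck_on_normalize 0 j)).
Qed.

(** Smoothness of one canonical extension, the one constant on rays, instead of unspecified local
    ones. *)
Definition smooth_ext f : Prop := smooth_on pct (f \o retr).

(** Near [x] the extension constant on rays is a local smooth extension [F] composed with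
    [normalize]. *)
Lemma smooth_sphereP f : smooth_sphere f <-> smooth_ext f.
Proof.
split=> [sf k|sf p]; last first.
  exists pct, (f \o retr); split => //; first exact: open_punctured.
    exact: val_punctured.
  by move=> q _; rewrite /= retractK.
apply: Ck_on_local => x x0; have [U [F [oU Ux sF FE]]] := sf (retr x).
pose W := [set y | pct y /\ U (normalize y)].
have oW : open W.
  rewrite openE => y [y0 Uy]; apply: filterI.
    exact: (open_nbhs_nbhs (conj (@open_punctured R m.+1) y0)).
  exact: normalize_continuous y0 _ (open_nbhs_nbhs (conj oU Uy)).
exists W; first by split => //; rewrite -val_retract.
have C : Ck_on k W (F \o normalize).
  apply: Ck_on_comp oW oU _ _ (sF k) => [y []//|j].
  by apply: (Ck_on_subset _ (Ck_on_normalize k j)) => y [].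
apply: Ck_on_eq oW _ C => y; rewrite inE => -[y0 Uy].
by rewrite /= -val_retract// FE// val_retract.
Qed.

(** The differential of [x / |x|] at a point of the sphere is the projection onto the tangent
    space. *)
Lemma derive_normalize p v i :
  'D_v (fun x => normalize x 0 i) (val p) = v 0 i - dot v (val p) * val p 0 i.
Proof.
have d1 := is_derive_coord i (val p) v.
have d2 := is_derive_rho v (val_punctured p).
have [_ D] := is_deriveM d2 d1.
rewrite (_ : (fun x => _) = (@rho R m.+1 * (fun y : 'rV[R]_m.+1 => y 0 i : R) : _ -> R)).
  rewrite D rho_val -![_ *: _]/(_ * _); ring.
by apply/funext => y; rewrite mxE.
Qed.

Lemma derive_normalize_comp (H : 'rV[R]_m.+1 -> R) p v :
  Ck_on 1 pct H ->
  'D_v (H \o normalize) (val p) = 'D_(tproj p v) H (val p).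
Proof.
move=> CH; have p0 := val_punctured p.
have pE : normalize (val p) = val p by rewrite /normalize rho_val scale1r.
have [dH _] := Ck_on_differentiable (@open_punctured R m.+1) CH p0.
rewrite -pE in dH.
have [||_ ->] := @derive_chain _ _ _ H normalize (val p) v => //.
  by move=> j; have [] := Ck_on_differentiable (@open_punctured R m.+1) (Ck_on_normalize 1 j) p0.
rewrite pE; congr (derive H (val p) _); apply/rowP => i.
by rewrite !mxE derive_normalize.
Qed.

Lemma radial_derive0 f x : pct x -> 'D_x (f \o retr) x = 0.
Proof.
move=> x0; apply: lim_near_cst => //; near=> h.
have h1 : 0 < 1 + h.
  have : `|h| < 1 by near: h; apply: dnbhs0_lt.
  by rewrite ltr_norml => /andP[+ _]; lra.
have E : h *: x + x = (1 + h) *: x by rewrite scalerDl scale1r addrC.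
by rewrite /= E retractZ// subrr scaler0.
Unshelve. all: by end_near. Qed.

Lemma tproj_tproj p v : tproj p (tproj p v) = tproj p v.
Proof.
rewrite {1}/tproj (_ : dot (tproj p v) (val p) = 0) ?scale0r ?subr0//.
by rewrite dotBl dotZl dot_val mulr1 subrr.
Qed.

Lemma tprojE p v i : tproj p v 0 i = v 0 i - dot v (val p) * val p 0 i.
Proof. by rewrite !mxE. Qed.

Lemma norm_evec_le1 i : `|e_ i : 'rV[R]_m.+1| <= 1.
Proof.
rewrite [leLHS]/Num.Def.normr/= mx_normrE bigmax_le//= => -[a b] _ /=.
by rewrite mxE; case: (_ && _); rewrite ?normr1 ?normr0.
Qed.

Section fixed.
Variables (f : usphere R m -> R) (sf : smooth_ext f).
Let G := f \o retr.

Lemma sgradE p i : sgrad f p 0 i = 'D_(e_ i) G (val p).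
Proof.
have p0 := val_punctured p.
have [dG D] := Ck_on_differentiable (@open_punctured R m.+1) (sf 1) p0.
rewrite mxE /sdiff -/G deriveE// /tproj linearB linearZ/= -!deriveE//.
by rewrite [X in _ *: X]radial_derive0// scaler0 subr0.
Qed.

(* [G] is homogeneous of degree 0, so its first and second radial derivatives vanish on the sphere
   and the spherical Laplacian is the Euclidean one. *)
Lemma slapE p : slap f p = \sum_i 'D_(e_ i) (fun y => 'D_(e_ i) G y) (val p).
Proof.
have p0 := val_punctured p; have opct := @open_punctured R m.+1.
pose H i := fun y => 'D_(e_ i) G y.
have CH i k : Ck_on k pct (H i) by exact: Ck_on_derive (sf k.+1).
have DH j v : 'D_v (H j) (val p) = \sum_k v 0 k * 'D_(e_ k) (H j) (val p).
  by have [_ ->] := Ck_on_differentiable opct (CH j 1) p0.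
(* Near [val p] the coordinates of the gradient, extended constantly on rays, are the
   [H j \o normalize], so only the tangential part of [v] matters. *)
have sd v : sdiff (sgrad f) p v = \row_j 'D_(tproj p v) (H j) (val p).
  rewrite /sdiff.
  have E : \forall y \near val p, (sgrad f \o retr) y = \row_j (H j \o normalize) y.
    apply: filterS (open_nbhs_nbhs (conj opct p0)) => y y0.
    by apply/rowP => j; rewrite [LHS]sgradE val_retract// !mxE.
  have FE j : (fun y => (\row_l (H l \o normalize) y) (0 : 'I_1) j) = H j \o normalize.
    by apply/funext => y; rewrite mxE.
  rewrite (near_eq_derive v E) derive_mx.
    apply/rowP => j; rewrite mxE [RHS]mxE FE.
    exact: derive_normalize_comp (CH j 1).
  apply/derivable_mxP => i j.
  rewrite ord1 FE.
  have C : Ck_on 1 pct (H j \o normalize).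
    apply: (Ck_on_comp opct opct _ _ (CH j 1)) => [y|l]; first exact: normalize_punctured.
    exact: Ck_on_normalize.
  by apply: diff_derivable; have [] := Ck_on_differentiable opct C p0.
pose P := val p 0.
pose A i j := 'D_(e_ i) (H j) (val p).
(* The identity [\sum_j y_j * H j y = 0], which says that the radial derivative vanishes, is
   differentiated once more along [val p]. *)
have rad : \sum_j P j * (\sum_k P k * A k j) = 0.
  pose E := fun y : 'rV[R]_m.+1 => \sum_j y 0 j * H j y.
  have E0 y : pct y -> E y = 0.
    move=> y0; have [_ D] := Ck_on_differentiable opct (sf 1) y0.
    by rewrite -(radial_derive0 f y0) D.
  have : 'D_(val p) E (val p) = 0.
    rewrite (@near_eq_derive _ _ _ E (cst 0)) ?derive_cst//.
    by apply: filterS (open_nbhs_nbhs (conj opct p0)) => y /E0.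
  have dj j : is_derive (val p) (val p) (fun y : 'rV[R]_m.+1 => y 0 j * H j y : R)
      (P j * H j (val p) + P j * (\sum_k P k * A k j)).
    have d1 := is_derive_coord j (val p) (val p).
    have [dH _] := Ck_on_differentiable opct (CH j 1) p0.
    have d2 := derivableP (diff_derivable (v := val p) dH).
    apply: is_derive_eq (is_deriveM d1 d2) _.
    rewrite -![_ *: _]/(_ * _) DH -/P [H j (val p) * _]mulrC addrC; congr (_ + _).
  have [_ DE] := is_derive_sum dj.
  rewrite (_ : E = \sum_j (fun y : 'rV[R]_m.+1 => y 0 j * H j y : R)); last first.
    by apply/funext => y; rewrite fct_sumE.
  by rewrite DE big_split/= -[X in X + _]/(E (val p)) E0// add0r.
have tA i j : 'D_(tproj p (e_ i)) (H j) (val p) = A i j - P i * \sum_k P k * A k j.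
  rewrite DH (eq_bigr (fun k => e_ i 0 k * A k j - P i * (P k * A k j))).
    rewrite big_split/= sumrN -mulr_sumr; congr (_ - _).
    rewrite (bigD1 i)//= big1 ?addr0 ?mxE ?eqxx ?mul1r// => k ki.
    by rewrite mxE (negPf ki) mul0r.
  move=> k _; have -> : tproj p (e_ i) 0 k = e_ i 0 k - P i * P k.
    by rewrite tprojE dotC dot_evec.
  by rewrite mulrBl mulrA.
rewrite /slap /sdiv.
transitivity (\sum_i ((A i i - P i * \sum_k P k * A k i)
    - P i * (\sum_j P j * (A i j - P i * \sum_k P k * A k j)))).
  apply: eq_bigr => i _; rewrite dot_evec /scov tprojE.
  have sdj j : sdiff (sgrad f) p (tproj p (e_ i)) 0 j = A i j - P i * \sum_k P k * A k j.
    by rewrite sd mxE tproj_tproj tA.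
  congr (_ - _); first exact: sdj.
  rewrite [RHS]mulrC; congr (_ * _).
  apply: eq_bigr => j _; rewrite [LHS]mulrC; congr (_ * _); exact: sdj.
exact: trace_radial.
Qed.

Lemma slap_ext : smooth_ext (slap f).
Proof.
move=> k; have opct := @open_punctured R m.+1.
pose L := fun y => \sum_i 'D_(e_ i) (fun y => 'D_(e_ i) G y) y.
have CL : Ck_on k pct L.
  apply: Ck_on_sum => // i; apply: Ck_on_derive.
  exact: (Ck_on_derive i (sf k.+2)).
have C : Ck_on k pct (L \o normalize).
  apply: (Ck_on_comp opct opct _ _ CL) => [y|l]; first exact: normalize_punctured.
  exact: Ck_on_normalize.
by apply: Ck_on_eq opct _ C => y; rewrite inE => y0; rewrite /= slapE val_retract.
Qed.

(** [G] takes only values of [f], so [val p] is also a maximum of [G] along each coordinate line,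
    where the second derivative is nonpositive. *)
Lemma slap_le0_at_max p : (forall q, f q <= f p) -> slap f p <= 0.
Proof.
move=> fmax; rewrite slapE; apply: sumr_le0 => i _.
have p0 := val_punctured p; have opct := @open_punctured R m.+1.
have [d /= d0 dP] := (iffLR (nbhs_normP _ _)) (open_nbhs_nbhs (conj opct p0)).
have line t : `|t| < d -> pct (val p + t *: e_ i).
  move=> td; apply: dP; rewrite /ball_/= opprD addrA subrr sub0r normrN normrZ.
  by apply: le_lt_trans td; rewrite ler_piMr// norm_evec_le1.
pose g (t : R) := G (val p + t *: e_ i).
pose dg (t : R) := 'D_(e_ i) G (val p + t *: e_ i).
have gd (t : R) : `|t| < d -> is_derive t (1 : R) g (dg t).
  by move=> td; apply: is_derive_line; exact: Ck_on_derivable (sf 1) (line _ td).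
have dgd : is_derive (0 : R) (1 : R) dg ('D_(e_ i) (fun y => 'D_(e_ i) G y) (val p)).
  have := @is_derive_line _ _ _ (fun y => 'D_(e_ i) G y) (val p) (e_ i) 0.
  rewrite scale0r addr0; apply.
  exact: Ck_on_derivable (Ck_on_derive i (sf 2)) p0.
apply: second_derivative_at_max d0 gd dgd _ => t _.
by rewrite /g scale0r addr0 /G/= retractK; exact: fmax.
Qed.

End fixed.
End sphere.

(** * Polynomials and harmonic polynomials *)

Section mpoly_calculus.
Variables (R : realType) (n : nat).
Implicit Types (p q h : mpoly n R).

Local Notation X_ i := (mpolyX R (@mnm1 n i)).
Local Notation homog d := (@ishomog1 n R d (@mdeg n)).

Lemma mpoly_ring_ind (P : mpoly n R -> Prop) :
  (forall c, P (mpolyC n c)) -> (forall i, P (X_ i)) ->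
  (forall p q, P p -> P q -> P (p + q)) -> (forall p q, P p -> P q -> P (p * q)) ->
  forall p, P p.
Proof.
move=> PC PX PD PM p; rewrite (mpolyE p).
have P0 : P 0 by have := PC 0; rewrite mpolyC0.
have P1 : P 1 by have := PC 1; rewrite mpolyC1.
apply: (big_ind P P0 PD) => k _.
rewrite -mul_mpolyC; apply: (PM) => //; rewrite mpolyXE_id.
by apply: (big_ind P P1 PM) => i _; elim: (k i) => [|d IH]; rewrite ?expr0 ?exprS//; exact: PM.
Qed.

Lemma mderiv_var i j : mderiv i (X_ j) = (i == j)%:R.
Proof.
rewrite mderivX mnm1E eq_sym; case: eqP => [->|]; last by rewrite scale0r.
rewrite scale1r (_ : mnm_sub _ _ = @mnm0 n) ?mpolyX0//.
by apply/mnmP => k; rewrite mnmBE subnn mnm0E.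
Qed.

Lemma homogD d p q : p \is homog d -> q \is homog d -> p + q \is homog d.
Proof. exact: dhomogD. Qed.

Lemma homogZ d c p : p \is homog d -> c *: p \is homog d.
Proof. exact: dhomogZ. Qed.

Lemma homog_sum d (I : Type) (r : seq I) (F : I -> mpoly n R) :
  (forall i, F i \is homog d) -> \sum_(i <- r) F i \is homog d.
Proof. by move=> H; apply: rpred_sum. Qed.

Lemma homog_var i : X_ i \is homog 1.
Proof. by rewrite dhomogX; apply/eqP; exact: mdeg1. Qed.

Lemma homog_mderiv d i q : q \is homog d -> mderiv i q \is homog d.-1.
Proof.
move=> /dhomogP qd; apply/dhomogP => k; rewrite mcoeff_msupp mcoeff_mderiv => H.
have /qd E : mnm_add k (mnm1 i) \in msupp q.
  by rewrite mcoeff_msupp; apply: contraNneq H => ->; rewrite mul0rn.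
have {}E : mdeg (mnm_add k (mnm1 i)) = d := E.
by rewrite -E mdegD mdeg1 addn1.
Qed.

Lemma mderiv_homog0 i q : q \is homog 0 -> mderiv i q = 0.
Proof.
move=> /dhomogP qd; apply/mpolyP => k; rewrite mcoeff0 mcoeff_mderiv.
rewrite memN_msupp_eq0 ?mul0rn//; apply/negP => /qd E.
have {}E : mdeg (mnm_add k (mnm1 i)) = 0%N := E.
by move: E; rewrite mdegD mdeg1 addn1.
Qed.

Lemma euler d q : q \is homog d -> \sum_i X_ i * mderiv i q = d%:R *: q.
Proof.
move=> /dhomogP qd; rewrite {1 2}(mpolyE q) scaler_sumr.
under eq_bigr do rewrite raddf_sum mulr_sumr.
rewrite exchange_big/= big_seq [RHS]big_seq; apply: eq_bigr => k /qd E.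
have {}E : mdeg k = d := E.
rewrite -E mdegE natr_sum scaler_suml; apply: eq_bigr => i _.
rewrite mderivZ mderivX -!scalerAr scalerA [RHS]scalerA [(k i)%:R * _]mulrC.
(* Subtraction of exponents is truncated, so [k i = 0] is set apart; both sides are then 0. *)
have [k0|k0] := posnP (k i); first by rewrite k0 !mulr0 !scale0r.
rewrite -mpolyXD addmC submK//.
by apply/mnm_lepP => j; rewrite mnm1E; case: eqP => // <-.
Qed.

Definition Lap q : mpoly n R := \sum_i mderiv i (mderiv i q).

Lemma LapD p q : Lap (p + q) = Lap p + Lap q.
Proof. by rewrite /Lap -big_split; apply: eq_bigr => i _; rewrite !mderivD. Qed.

Lemma LapZ c p : Lap (c *: p) = c *: Lap p.
Proof. by rewrite /Lap scaler_sumr; apply: eq_bigr => i _; rewrite !mderivZ. Qed.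

Lemma homog_Lap d q : q \is homog d -> Lap q \is homog d.-2.
Proof.
by move=> qd; apply: homog_sum => i; exact: (homog_mderiv _ (homog_mderiv _ qd)).
Qed.

Lemma Lap_homog_le1 d q : (d <= 1)%N -> q \is homog d -> Lap q = 0.
Proof.
move=> d1 qd; rewrite /Lap big1// => i _; apply: mderiv_homog0.
by have := homog_mderiv i qd; rewrite (_ : d.-1 = 0%N)//; case: d d1 {qd} => [|[]].
Qed.

Lemma LapM p q :
  Lap (p * q) = Lap p * q + (\sum_i mderiv i p * mderiv i q) *+ 2 + p * Lap q.
Proof.
rewrite /Lap mulr_suml mulr_sumr -sumrMnl -!big_split/=; apply: eq_bigr => i _.
by rewrite !(mderivM, mderivD) mulr2n !addrA.
Qed.

Definition sqn : mpoly n R := \sum_i X_ i ^+ 2.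

Lemma homog_sqn : sqn \is homog 2.
Proof. by apply: homog_sum => i; exact: (dhomogMn 2 (homog_var i)). Qed.

Lemma mderiv_sqn i : mderiv i sqn = X_ i *+ 2.
Proof.
rewrite /sqn raddf_sum/= (bigD1 i)//= big1 ?addr0 => [|j ji].
  by rewrite expr2 mderivM mderiv_var eqxx mulr1 mul1r -mulr2n.
by rewrite expr2 mderivM mderiv_var eq_sym (negPf ji) mulr0 mul0r addr0.
Qed.

(** The Laplacian of [sqn] is the constant [2 * n], and by Euler's identity the cross term is
    [4 * d] times [q]. *)
Lemma Lap_sqnM d q : q \is homog d ->
  Lap (sqn * q) = (2 * n + 4 * d)%:R *: q + sqn * Lap q.
Proof.
move=> qd; rewrite LapM; congr (_ + _).
have -> : Lap sqn = (2 * n)%:R.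
  rewrite /Lap (eq_bigr (fun=> 2%:R)) => [|i _].
    by rewrite sumr_const card_ord -mulrnA.
  by rewrite mderiv_sqn mderivMn mderiv_var eqxx.
rewrite (eq_bigr (fun i => (X_ i * mderiv i q) *+ 2)) => [|i _].
  rewrite sumrMnl (euler qd) -mulrnA mulr_natl.
  by rewrite -[q *+ _]scaler_nat -[_ *: q *+ _]scaler_nat scalerA -scalerDl -natrM -natrD.
by rewrite mderiv_sqn mulrnAl.
Qed.

(* Look for q = g / a + sqn * r: the equation for r has the same shape in degree d - 2, with a
   larger constant. *)
Lemma sqn_Lap_solve d (a : R) g : 0 < a -> g \is homog d ->
  exists2 q, q \is homog d & a *: q + sqn * Lap q = g.
Proof.
elim/ltn_ind : d a g => d IH a g a0 gd.
have aN0 : a != 0 by rewrite gt_eqF.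
have ga : a^-1 *: g \is homog d by exact: homogZ.
have [d1|d2] := leqP d 1.
  exists (a^-1 *: g) => //.
  by rewrite (Lap_homog_le1 d1 ga) mulr0 addr0 scalerA mulfV// scale1r.
have [r rd rE] : exists2 r, r \is homog d.-2 &
    (a + (2 * n + 4 * d.-2)%:R) *: r + sqn * Lap r = - Lap (a^-1 *: g).
  apply: IH; [lia|by rewrite ltr_wpDr|].
  by rewrite -scaleN1r; apply: homogZ; exact: homog_Lap.
exists (a^-1 *: g + sqn * r).
  apply: homogD => //; rewrite (_ : d = 2 + d.-2)%N; last by lia.
  exact: dhomogM homog_sqn rd.
rewrite LapD (Lap_sqnM rd) scalerDr scalerA mulfV// scale1r -[RHS]addr0 -addrA; congr (_ + _).
rewrite -[Lap (a^-1 *: g)]opprK -rE scalerDl !mulrDr mulrN -!scalerAr !mulrDr -!scalerAr.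
by rewrite opprD addrA; ring.
Qed.

(** By [Lap_sqnM], [p - sqn * q] is harmonic exactly when [q] solves the equation of [sqn_Lap_solve]
    with constant [2 * n + 4 * d] and right side [Lap p]. *)
Lemma harmonic_split d p : p \is homog d.+2 ->
  exists h q, [/\ h \is homog d.+2, Lap h = 0, q \is homog d & p = h + sqn * q].
Proof.
(* With no variables the constant may be 0, but then every polynomial is harmonic. *)
move=> pd; have [n0|n0] := posnP n.
  exists p, 0; split; rewrite ?mulr0 ?addr0 ?dhomog0//.
  by rewrite /Lap big1// => -[i ilt]; exfalso; rewrite n0 in ilt.
have c0 : 0 < (2 * n + 4 * d)%:R :> R by rewrite ltr0n; lia.
have [q qd qE] := sqn_Lap_solve c0 (homog_Lap pd).
have sqd : sqn * q \is homog d.+2 by exact: (dhomogM homog_sqn qd).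
exists (p - sqn * q), q; split => //.
- by apply: homogD => //; rewrite -scaleN1r; exact: homogZ.
- by rewrite LapD -scaleN1r LapZ (Lap_sqnM qd) qE scaleN1r subrr.
- by rewrite subrK.
Qed.

End mpoly_calculus.

(** * Polynomials as smooth functions *)

Section poly_functions.
Variables (R : realType) (n : nat).
Implicit Types (p q : mpoly n R) (x : 'rV[R]_n).
Local Notation e_ i := (evec R i).

(** [restrict_sphere q p] is convertible to [pev q (val p)]; proofs pass freely between the two. *)
Definition pev q x : R := meval (fun i => x 0 i) q.

Lemma pevD p q x : pev (p + q) x = pev p x + pev q x. Proof. exact: mevalD. Qed.
Lemma pevM p q x : pev (p * q) x = pev p x * pev q x. Proof. exact: mevalM. Qed.
Lemma pevZ c p x : pev (c *: p) x = c * pev p x. Proof. exact: mevalZ. Qed.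
Lemma pevX i x : pev (mpolyX R (mnm1 i)) x = x 0 i. Proof. exact: mevalXU. Qed.
Lemma pevC c x : pev (mpolyC n c) x = c. Proof. exact: mevalC. Qed.
Lemma pev_sum (I : Type) (r : seq I) (F : I -> mpoly n R) x :
  pev (\sum_(i <- r) F i) x = \sum_(i <- r) pev (F i) x.
Proof. by rewrite /pev raddf_sum. Qed.

Lemma is_derive_pev q i x : is_derive x (e_ i) (pev q) (pev (mderiv i q) x).
Proof.
elim/mpoly_ring_ind : q => [c|j|p q dp dq|p q dp dq].
- rewrite mderivC (_ : pev (mpolyC n c) = cst c).
    by rewrite /pev meval0; exact: is_derive_cst.
  by apply/funext => y; rewrite pevC.
- rewrite mderiv_var (_ : pev (mpolyX R (mnm1 j)) = fun y => y 0 j).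
    have := is_derive_coord j x (e_ i); rewrite mxE eqxx/= eq_sym.
    by case: (i == j); rewrite /pev ?meval0 ?meval1.
  by apply/funext => y; rewrite pevX.
- rewrite mderivD pevD (_ : pev (p + q) = pev p + pev q); first exact: is_deriveD.
  by apply/funext => y; exact: pevD.
- rewrite mderivM pevD !pevM (_ : pev (p * q) = pev p * pev q).
    by apply: is_derive_eq (is_deriveM dp dq) _; rewrite -![_ *: _]/(_ * _) addrC mulrC.
  by apply/funext => y; exact: pevM.
Qed.

Lemma Ck_on_pev k U q : open U -> Ck_on k U (pev q).
Proof.
move=> oU; elim/mpoly_ring_ind : q => [c|j|p q dp dq|p q dp dq].
- by rewrite (_ : pev _ = cst c); [exact: Ck_on_cst|apply/funext => y; rewrite pevC].
- by rewrite (_ : pev _ = fun y => y 0 j); [exact: Ck_on_coord|apply/funext => y; rewrite pevX].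
- rewrite (_ : pev _ = fun y => pev p y + pev q y); first exact: Ck_onD.
  by apply/funext => y; exact: pevD.
- rewrite (_ : pev _ = fun y => pev p y * pev q y); first exact: Ck_onM.
  by apply/funext => y; exact: pevM.
Qed.

Lemma pev_homog d q (c : R) x : q \is @ishomog1 n R d (@mdeg n) ->
  pev q (c *: x) = c ^+ d * pev q x.
Proof.
move=> /dhomogP qd; rewrite /pev !mevalE mulr_sumr big_seq [RHS]big_seq.
apply: eq_bigr => k /qd E; have {}E : mdeg k = d := E.
rewrite mulrCA; congr (_ * _); rewrite -E mdegE -prodrXr -big_split.
by apply: eq_bigr => i _; rewrite mxE exprMn.
Qed.

(** Sums of polynomials times powers of [1 / |x|] are stable under differentiation; the extension
    constant on rays of a homogeneous polynomial of degree [d] has this form with [a = d]. *)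
Lemma is_derive_pev_rho q a i x : x != 0 ->
  is_derive x (e_ i) (fun y => pev q y * rho y ^+ a)
   (pev (mderiv i q) x * rho x ^+ a -
    a%:R * (pev (mpolyX R (mnm1 i) * q) x * rho x ^+ a.+2)).
Proof.
move=> x0; have d1 := is_derive_pev q i x.
have d2 := is_deriveX a (is_derive_rho (e_ i) x0).
rewrite exprfctE in d2.
apply: is_derive_eq (is_deriveM d1 d2) _.
rewrite pevM pevX dotC dot_evec -![_ *: _]/(_ * _).
case: a {d2} => [|a]; first by rewrite !expr0 !mul0r; ring.
rewrite /= !exprS; ring.
Qed.

End poly_functions.

(** * The spherical Laplacian of polynomials *)

Section poly_sphere.
Variables (R : realType) (m : nat).
Implicit Types (p : usphere R m) (f g : usphere R m -> R) (q : mpoly m.+1 R).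
Local Notation pct := (@punctured R m.+1).
Local Notation e_ i := (evec R i).
Local Notation opct := (@open_punctured R m.+1).

Lemma smooth_ext_restrict q : smooth_ext (restrict_sphere q).
Proof.
apply/smooth_sphereP => p; exists setT, (pev q); split => //; first exact: openT.
by move=> k; apply: Ck_on_pev; exact: openT.
Qed.

Lemma smooth_extD f g : smooth_ext f -> smooth_ext g -> smooth_ext (fun p => f p + g p).
Proof. by move=> sf sg k; apply: (Ck_onD opct (sf k) (sg k)). Qed.

Lemma smooth_extM f g : smooth_ext f -> smooth_ext g -> smooth_ext (fun p => f p * g p).
Proof. by move=> sf sg k; apply: (Ck_onM opct (sf k) (sg k)). Qed.

Lemma smooth_ext_cst c : smooth_ext (cst c : usphere R m -> R).
Proof. by move=> k; exact: Ck_on_cst. Qed.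

Lemma smooth_extZ c f : smooth_ext f -> smooth_ext (fun p => c * f p).
Proof. exact: smooth_extM (smooth_ext_cst c). Qed.

Lemma derive2_lin (F G : 'rV[R]_m.+1 -> R) (c : R) i x : pct x ->
  Ck_on 2 pct F -> Ck_on 2 pct G ->
  'D_(e_ i) (fun y => 'D_(e_ i) (fun z => F z + c * G z) y) x =
  'D_(e_ i) (fun y => 'D_(e_ i) F y) x + c * 'D_(e_ i) (fun y => 'D_(e_ i) G y) x.
Proof.
move=> x0 CF CG.
have lin (A B : 'rV[R]_m.+1 -> R) y : derivable A y (e_ i) -> derivable B y (e_ i) ->
    'D_(e_ i) (fun z => A z + c * B z) y = 'D_(e_ i) A y + c * 'D_(e_ i) B y.
  move=> dA dB; have H := is_deriveD (derivableP dA) (is_deriveZ c (derivableP dB)).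
  by have [_ D] := H; exact: D.
rewrite (near_eq_derive (g := fun y => 'D_(e_ i) F y + c * 'D_(e_ i) G y)).
  apply: lin; first exact: Ck_on_derivable (Ck_on_derive i CF) x0.
  exact: Ck_on_derivable (Ck_on_derive i CG) x0.
apply: filterS (open_nbhs_nbhs (conj opct x0)) => y y0.
by apply: lin; [exact: Ck_on_derivable (Ck_onW CF) y0|exact: Ck_on_derivable (Ck_onW CG) y0].
Qed.

Lemma slap_lin f g c p : smooth_ext f -> smooth_ext g ->
  slap (fun p => f p + c * g p) p = slap f p + c * slap g p.
Proof.
move=> sf sg.
have sfg : smooth_ext (fun p => f p + c * g p) by apply: smooth_extD => //; exact: smooth_extZ.
rewrite (slapE sfg) (slapE sf) (slapE sg) mulr_sumr -big_split/=.
apply: eq_bigr => i _.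
exact: derive2_lin (val_punctured p) (sf 2) (sg 2).
Qed.

Lemma slapD f g p : smooth_ext f -> smooth_ext g ->
  slap (fun p => f p + g p) p = slap f p + slap g p.
Proof.
move=> sf sg; have := slap_lin 1 p sf sg; rewrite mul1r => <-.
by congr (slap _ p); apply/funext => r; rewrite mul1r.
Qed.

Lemma slap_cst c p : slap (cst c : usphere R m -> R) p = 0.
Proof.
rewrite (slapE (smooth_ext_cst c)) big1// => i _.
have E : (fun y => 'D_(e_ i) (cst c \o @retract R m) y) = cst 0.
  by apply/funext => y; exact: derive_cst.
by rewrite E derive_cst.
Qed.

Lemma slapZ c g p : smooth_ext g -> slap (fun p => c * g p) p = c * slap g p.
Proof.
move=> sg; have := slap_lin c p (smooth_ext_cst 0) sg.
rewrite slap_cst add0r => <-.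
by congr (slap _ p); apply/funext => r; rewrite add0r.
Qed.

(** The extension constant on rays is [q x / |x| ^ d]. In the sum of its second derivatives, Euler's
    identity and [|x| = 1] turn the terms other than [Lap q] into [- 2 d^2 - d (m + 1) + d (d + 2) =
    - d (m + d - 1)] times [q]. *)
Lemma slap_restrict d q p : q \is @ishomog1 m.+1 R d (@mdeg m.+1) ->
  slap (restrict_sphere q) p =
  restrict_sphere (Lap q) p - lambda R m d * restrict_sphere q p.
Proof.
move=> qd; rewrite (slapE (smooth_ext_restrict q)).
pose X i := mpolyX R (@mnm1 m.+1 i).
have p0 := val_punctured p.
have D1 i y : pct y -> 'D_(e_ i) (restrict_sphere q \o @retract R m) y =
   pev (mderiv i q) y * rho y ^+ d + (- d%:R) * (pev (X i * q) y * rho y ^+ d.+2).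
  move=> y0; rewrite (near_eq_derive (g := fun y => pev q y * rho y ^+ d)).
    by have [_ ->] := is_derive_pev_rho q d i y0; rewrite mulNr.
  apply: filterS (open_nbhs_nbhs (conj opct y0)) => z z0.
  rewrite [LHS](_ : _ = pev q (val (retract z)))// val_retract// (pev_homog _ _ qd).
  by rewrite mulrC.
have D2 i : 'D_(e_ i) (fun y => 'D_(e_ i) (restrict_sphere q \o @retract R m) y) (val p) =
   pev (mderiv i (mderiv i q)) (val p)
   - (2 * d%:R) * pev (X i * mderiv i q) (val p) - d%:R * pev q (val p)
   + d%:R * (d%:R + 2) * ((val p 0 i * val p 0 i) * pev q (val p)).
  rewrite (near_eq_derive (g := fun y => pev (mderiv i q) y * rho y ^+ d +
    (- d%:R) * (pev (X i * q) y * rho y ^+ d.+2))); last first.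
    by apply: filterS (open_nbhs_nbhs (conj opct p0)) => y /D1.
  have d1 := is_derive_pev_rho (mderiv i q) d i p0.
  have d2 := is_derive_pev_rho (X i * q) d.+2 i p0.
  have H := is_deriveD d1 (is_deriveZ (- d%:R) d2).
  have [_ DH] := H.
  rewrite [LHS]DH rho_val !expr1n -![_ *: _]/(_ * _) mderivM mderiv_var eqxx mul1r.
  rewrite !(pevD, pevM) pevX -[d.+2%:R]natr1 -natr1; ring.
rewrite (eq_bigr _ (fun i _ => D2 i)) big_split/= !sumrB.
rewrite -!mulr_sumr -mulr_suml -[\sum_(i < m.+1) val p 0 i * _]/(dot (val p) (val p)) dot_val mul1r.
rewrite sumr_const card_ord -!pev_sum -/(Lap q) (euler qd) pevZ.
rewrite -[pev (Lap q) _]/(restrict_sphere (Lap q) p) -[pev q _]/(restrict_sphere q p).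
rewrite /lambda -mulr_natr -natr1; ring.
Qed.

End poly_sphere.

(** * Uniform approximation by polynomials *)

Lemma expr_small (R : realType) (z e : R) : 0 <= z -> z < 1 -> 0 < e -> exists k : nat, z ^+ k <= e.
Proof.
move=> z0 z1 e0.
have : (fun k : nat => z ^+ k) @ \oo --> (0 : R) by apply: cvg_expr; rewrite ger0_norm.
move=> /cvgrPdist_le /(_ _ e0) [k _ /(_ k (leqnn k))] /=.
by rewrite sub0r normrN ger0_norm ?exprn_ge0//; exists k.
Qed.

(* For [half] = 1/2 and 0 <= t <= 1 this converges uniformly to the square root of t. *)
Fixpoint sqrt_iter (A : nzRingType) (half t : A) (k : nat) : A :=
  if k is k'.+1 then
    sqrt_iter half t k' + half * (t - sqrt_iter half t k' ^+ 2)
  else 0.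

(** The error satisfies [u_(j+1) = u_j * (1 - (t + r_j) / 2)], hence [u_j <= (1 - t / 2) ^+ j]. This
    is small enough when [t > e]; when [t <= e] the bound [u_j <= t] suffices. *)
Lemma sqrt_iter_abs (R : realType) (t e : R) (k : nat) : 0 <= t <= 1 -> 0 < e -> e <= 1 ->
  (1 - e / 2) ^+ k <= e -> `|t - sqrt_iter 2^-1 (t ^+ 2) k| <= e.
Proof.
move=> /andP[t0 t1] e0 e1 ke; set r := sqrt_iter _ _.
have alg (s : R) : t - (s + 2^-1 * (t ^+ 2 - s ^+ 2)) = (t - s) * (1 - (t + s) / 2) by field.
have step j : 0 <= r j <= t /\ t - r j <= (1 - t / 2) ^+ j.
  elim: j => [|j [/andP[r0 rt] IH]].
    by rewrite /= subr0 expr0 lexx t0.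
  have E : t - r j.+1 = (t - r j) * (1 - (t + r j) / 2).
    exact: alg.
  have u0 : 0 <= t - r j.+1 by rewrite E mulr_ge0//; lra.
  split.
    rewrite -[_ <= t]subr_ge0 u0 andbT [r j.+1]/(r j + 2^-1 * (t ^+ 2 - r j ^+ 2)).
    by rewrite addr_ge0// mulr_ge0 ?invr_ge0// subr_ge0 lerXn2r ?nnegrE.
  rewrite E exprSr; apply: ler_pM => //; lra.
have [/andP[r0 rt] u] := step k.
rewrite ger0_norm ?subr_ge0//.
have [te|et] := leP t e; first by apply: le_trans te; rewrite gerBl.
apply: le_trans u (le_trans _ ke).
by apply: lerXn2r; rewrite ?nnegrE; lra.
Qed.

(** * Compactness of the sphere and the Weierstrass theorem *)

Section sphere_topology.
Import finmap.
Variables (R : realType) (m : nat).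
Implicit Types (p r : usphere R m) (f g : usphere R m -> R) (q : mpoly m.+1 R).

(** Continuity expressed through the extension constant on rays, so that the results on functions of
    ['rV[R]_m.+1] apply. *)
Definition sphere_cont f : Prop := forall p, {for val p, continuous (f \o @retract R m)}.

Lemma smooth_ext_cont f : smooth_ext f -> sphere_cont f.
Proof. by move=> sf p; exact: (Ck_on_cont (sf 0) (val_punctured p)). Qed.

Lemma sphere_contD f g : sphere_cont f -> sphere_cont g -> sphere_cont (fun p => f p + g p).
Proof. by move=> cf cg p; exact: (continuousD (cf p) (cg p)). Qed.

Lemma sphere_contM f g : sphere_cont f -> sphere_cont g -> sphere_cont (fun p => f p * g p).
Proof. by move=> cf cg p; exact: (continuousM (cf p) (cg p)). Qed.

Lemma sphere_cont_cst c : sphere_cont (fun=> c).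
Proof. by move=> p; exact: cst_continuous. Qed.

Lemma sphere_contZ c f : sphere_cont f -> sphere_cont (fun p => c * f p).
Proof. exact: sphere_contM (@sphere_cont_cst c). Qed.

Lemma sphere_cont_restrict q : sphere_cont (restrict_sphere q).
Proof. exact/smooth_ext_cont/smooth_ext_restrict. Qed.

Definition sphere_set : set 'rV[R]_m.+1 := [set x | dot x x = 1].

Lemma norm_sqr_le_dot (x : 'rV[R]_m.+1) : `|x| ^+ 2 <= dot x x.
Proof.
have [->|x0] := eqVneq x 0; first by rewrite normr0 expr0n/= dot_ge0.
have : mx_norm x != 0 by apply: contra x0 => /eqP/mx_norm_eq0/eqP.
move=> /mx_norm_neq0 [[a i] /= E].
have -> : `|x| = `|x a i| by exact: E.
rewrite ord1 real_normK ?num_real//.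
by rewrite /dot (bigD1 i)//= expr2 lerDl sumr_ge0// => j _; rewrite -expr2 sqr_ge0.
Qed.

Lemma sphere_compact : compact sphere_set.
Proof.
apply: bounded_closed_compact.
  exists 1; split; first exact: num_real.
  move=> M M1 x /= xS; apply: le_trans (ltW M1).
  by rewrite -(@ler_pXn2r _ 2) ?nnegrE// expr1n (le_trans (norm_sqr_le_dot x))// xS.
rewrite (_ : sphere_set = (fun x => dot x x) @^-1` [set 1])//.
apply: closed_comp => [x _|]; last exact: closed_eq.
exact: (Ck_on_cont (@Ck_on_dot R m.+1 0 setT openT) I).
Qed.

Lemma sphere_set_val (x : 'rV[R]_m.+1) : sphere_set x -> exists p, val p = x.
Proof. by move=> /eqP xS; exists (exist _ x xS). Qed.

Lemma sphere_max f : sphere_cont f -> exists p, forall r, f r <= f p.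
Proof.
move=> cf.
have [||c cS cmax] := @EVT_max_rV R _ (f \o @retract R m) sphere_set _ sphere_compact.
- by exists (val (pole R m)); exact: dot_val.
- apply: continuous_in_subspaceT => x /set_mem/sphere_set_val[p <-]; exact: cf.
have [p pc] := sphere_set_val (set_mem cS).
exists p => r; have := cmax (val r) (mem_set (dot_val r)).
by rewrite -pc /= !retractK.
Qed.

Lemma sphere_min f : sphere_cont f -> exists p, forall r, f p <= f r.
Proof.
move=> /(sphere_contZ (c := -1))/sphere_max[p H]; exists p => r.
by have := H r; rewrite !mulN1r lerN2.
Qed.

Lemma sphere_bound f : sphere_cont f -> exists2 M, 0 < M & forall p, `|f p| <= M.
Proof.
move=> cf; have [a fa] := sphere_max cf; have [b fb] := sphere_min cf.
exists (`|f a| + `|f b| + 1) => [|p]; first by rewrite ltr_wpDl// addr_ge0.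
have := fa p; have := fb p; have := ler_norm (f a); have := lerNnormlW (lexx `|f b|).
have := normr_ge0 (f a); have := normr_ge0 (f b).
by rewrite ler_norml => *; lra.
Qed.

Definition approximable f : Prop :=
  forall e : R, 0 < e -> exists q, forall p, `|f p - restrict_sphere q p| <= e.

Lemma restrictD q1 q2 p : restrict_sphere (q1 + q2) p = restrict_sphere q1 p + restrict_sphere q2 p.
Proof. exact: pevD. Qed.
Lemma restrictM q1 q2 p : restrict_sphere (q1 * q2) p = restrict_sphere q1 p * restrict_sphere q2 p.
Proof. exact: pevM. Qed.
Lemma restrictZ c q p : restrict_sphere (c *: q) p = c * restrict_sphere q p.
Proof. exact: pevZ. Qed.
Lemma restrictC c p : restrict_sphere (mpolyC m.+1 c) p = c.
Proof. exact: pevC. Qed.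

Lemma restrictB q1 q2 p : restrict_sphere (q1 - q2) p = restrict_sphere q1 p - restrict_sphere q2 p.
Proof. exact: mevalB. Qed.
Lemma restrictX q d p : restrict_sphere (q ^+ d) p = restrict_sphere q p ^+ d.
Proof. by rewrite /restrict_sphere rmorphXn. Qed.

Lemma approximable_restrict q : approximable (restrict_sphere q).
Proof. by move=> e e0; exists q => p; rewrite subrr normr0 ltW. Qed.

Lemma approximable_lin f g (c : R) : approximable f -> approximable g ->
  approximable (fun p => f p + c * g p).
Proof.
move=> Af Ag e e0.
have [q1 H1] := Af (e / 2) ltac:(lra).
have c0 : 0 < `|c| + 1 by rewrite ltr_wpDl.
have [q2 H2] := Ag (e / 2 / (`|c| + 1)) ltac:(by rewrite divr_gt0//; lra).
exists (q1 + c *: q2) => p; rewrite restrictD restrictZ.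
rewrite (_ : _ - _ = (f p - restrict_sphere q1 p) + c * (g p - restrict_sphere q2 p)); last by ring.
apply: le_trans (ler_normD _ _) _; rewrite normrM.
have : `|c| * `|g p - restrict_sphere q2 p| <= e / 2.
  apply: le_trans (ler_wpM2l (normr_ge0 _) (H2 p)) _.
  by rewrite mulrCA ler_piMr ?ler_pdivrMr ?mul1r//; lra.
by have := H1 p; lra.
Qed.

(** After rescaling to values in [-1, 1], the iteration for the square root of the square is run
    inside the polynomial ring. *)
Lemma approximable_abs_restrict q : approximable (fun p => `|restrict_sphere q p|).
Proof.
move=> e e0.
have [M M0 HM] := sphere_bound (@sphere_cont_restrict q).
(* Undoing the rescaling multiplies the error by [M]; [sqrt_iter_abs] moreover asks for an error of
   at most 1. *)
pose d := Num.min (e / M) 1.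
have d0 : 0 < d by rewrite lt_min ltr01 andbT divr_gt0.
have d1 : d <= 1 by rewrite ge_min lexx orbT.
have de : d * M <= e by rewrite -ler_pdivlMr// ge_min lexx.
have [k kd] := @expr_small R (1 - d / 2) d ltac:(lra) ltac:(lra) d0.
pose g := M^-1 *: q.
exists (M *: sqrt_iter (mpolyC m.+1 2^-1) (g ^+ 2) k) => p.
rewrite restrictZ.
have E j : restrict_sphere (sqrt_iter (mpolyC m.+1 2^-1) (g ^+ 2) j) p =
    sqrt_iter 2^-1 (`|restrict_sphere g p| ^+ 2) j.
  elim: j => [|j IH /=]; first exact: meval0.
  by rewrite restrictD restrictM restrictC restrictB !restrictX IH real_normK ?num_real.
have gE : restrict_sphere q p = M * restrict_sphere g p.
  by rewrite restrictZ mulrA mulfV ?mul1r// gt_eqF.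
rewrite E gE normrM (gtr0_norm M0) -mulrBr normrM (gtr0_norm M0).
apply: le_trans de; rewrite mulrC ler_wpM2r ?(ltW M0)//.
apply: sqrt_iter_abs => //; rewrite normr_ge0/=.
by rewrite -(ler_pM2l M0) mulr1 -[X in X * _](gtr0_norm M0) -normrM -gE HM.
Qed.

(** The minimum is [(f + g - |f - g|) / 2], and the absolute value of an approximable function is
    close to that of an approximating polynomial. *)
Lemma approximable_min f g : approximable f -> approximable g ->
  approximable (fun p => Num.min (f p) (g p)).
Proof.
move=> Af Ag.
have abs h : approximable h -> approximable (fun p => `|h p|).
  move=> Ah e e0; have [q1 H1] := Ah (e / 2) ltac:(lra).
  have [q2 H2] := @approximable_abs_restrict q1 (e / 2) ltac:(lra).
  exists q2 => p.
  rewrite (_ : _ - _ = (`|h p| - `|restrict_sphere q1 p|) +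
    (`|restrict_sphere q1 p| - restrict_sphere q2 p)); last by ring.
  apply: le_trans (ler_normD _ _) _.
  have := le_trans (ler_dist_dist _ _) (H1 p); have := H2 p; lra.
have := approximable_lin (-1) (approximable_lin 1 Af Ag) (abs _ (approximable_lin (-1) Af Ag)).
move=> H e e0; have [q Hq] := H (e * 2) ltac:(lra).
exists (2^-1 *: q) => p; rewrite restrictZ.
have := Hq p; rewrite mul1r !mulN1r.
rewrite !ler_norml.
have [fg|gf] := leP (f p) (g p).
  by rewrite ler0_norm ?subr_le0//; lra.
by rewrite gtr0_norm ?subr_gt0//; lra.
Qed.

(* Near f from above: the minimum of finitely many polynomials f y + e + L |x - y|^2, with L so
   large (depending on y) that each of them dominates f. *)
Lemma sphere_weierstrass f : sphere_cont f -> approximable f.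
Proof.
(* Up to three [e] separate [f] from the minimum [G] below, and one is spent on approximating
   [G]. *)
move=> cf e0' e0'0; pose e := e0' / 4; have e0 : 0 < e by rewrite divr_gt0.
have [M M0 HM] := sphere_bound cf.
pose sq (y : 'rV[R]_m.+1) : mpoly m.+1 R := \sum_i (mpolyX R (mnm1 i) - mpolyC m.+1 (y 0 i)) ^+ 2.
have sqE y x : pev (sq y) x = dot (x - y) (x - y).
  rewrite pev_sum; apply: eq_bigr => i _.
  by rewrite expr2 pevM -scaleN1r pevD pevZ pevX pevC !mxE mulN1r.
have H (y : 'rV[R]_m.+1) : exists L : R, sphere_set y -> 0 <= L /\ forall p,
    f p <= f (retract y) + e + L * dot (val p - y) (val p - y).
  have [yS|] := pselect (sphere_set y); last by exists 0.
  have [p0 p0y] := sphere_set_val yS.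
  have /cvgrPdist_le/(_ _ e0)/nbhs_ballP[d /= d0 Hd] := cf p0.
  (* Within distance [d] of [y] continuity gives the bound; farther away the quadratic term is at
     least [2 * M], hence at least any difference of values of [f]. *)
  exists (2 * M / d ^+ 2) => _; split; first by rewrite divr_ge0// ?mulr_ge0// ?exprn_ge0// ltW.
  move=> p; have [pd|dp] := ltP `|val p - y| d.
    have : ball (val p0) d (val p) by rewrite -ball_normE/= p0y distrC.
    move=> /Hd /=; rewrite !retractK -p0y retractK ler_norml => /andP[h _].
    have : 0 <= 2 * M / d ^+ 2 * dot (val p - val p0) (val p - val p0).
      by rewrite mulr_ge0 ?dot_ge0// divr_ge0// ?mulr_ge0// ?exprn_ge0// ltW.
    by move: h; lra.
  have : 2 * M <= 2 * M / d ^+ 2 * dot (val p - y) (val p - y).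
    rewrite -mulrA ler_peMr ?mulr_ge0 ?(ltW M0)// mulrC ler_pdivlMr ?exprn_gt0// mul1r.
    by apply: le_trans (norm_sqr_le_dot _); rewrite ler_pXn2r ?nnegrE// ltW.
  by have := HM p; have := HM (retract y); rewrite !ler_norml => /andP[? ?] /andP[? ?]; lra.
have [L HL] := choice H.
pose K (y : 'rV[R]_m.+1) : mpoly m.+1 R := mpolyC m.+1 (f (retract y) + e) + L y *: sq y.
have KE y x : pev (K y) x = f (retract y) + e + L y * dot (x - y) (x - y).
  by rewrite pevD pevZ pevC sqE.
(* At [y] the polynomial [K y] exceeds [f] by exactly [e], so it stays below [f + 3 e] on a
   neighbourhood of [y]; finitely many of these cover the sphere. *)
pose U (y : 'rV[R]_m.+1) : set 'rV[R]_m.+1 := [set x | pev (K y) x < f (retract x) + e * 3]°.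
have yU y : sphere_set y -> U y y.
  move=> yS; have [p py] := sphere_set_val yS.
  have c1 : {for y, continuous (fun x => f (retract x) - pev (K y) x)}.
    rewrite -py; apply: continuousB; first exact: cf.
    exact: (Ck_on_cont (Ck_on_pev 0 _ openT) I).
  have /cvgrPdist_lt/(_ e e0) := c1.
  apply: filterS => x; rewrite /= KE subrr /dot (eq_bigr (fun=> 0)) => [|i _].
    by rewrite big1// mulr0 addr0 ltr_norml => /andP[_]; lra.
  by rewrite mxE mul0r.
have : cover_compact sphere_set by rewrite -compact_cover; exact: sphere_compact.
move=> /(_ 'rV[R]_m.+1 sphere_set U)[|x xS|D DS DU].
- by move=> y _; exact: open_interior.
- by exists x => //; exact: yU.
(* The starting value [M] is harmless: it is above [f], and the upper bound for [G] comes from a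
   polynomial whose neighbourhood contains [p]. *)
pose G p := foldr (fun y acc => Num.min (restrict_sphere (K y) p) acc) M (enum_fset D).
have AG : approximable G.
  rewrite /G; elim: (enum_fset D) => [|y s IH] /=.
    rewrite (_ : (fun p => M) = restrict_sphere (mpolyC m.+1 M)).
      exact: approximable_restrict.
    by apply/funext => p; rewrite restrictC.
  exact: approximable_min (approximable_restrict _) IH.
have fG p : f p <= G p.
  have KD y : y \in D -> f p <= restrict_sphere (K y) p.
    move=> yD; have yS : sphere_set y by exact/set_mem/DS.
    by rewrite [leRHS]KE; have [_ ->] := HL y yS.
  rewrite /G; have : {subset enum_fset D <= D} by [].
  elim: (enum_fset D) => [_|y s IH sub] /=; first exact: le_trans (ler_norm _) (HM p).
  rewrite le_min KD ?sub ?mem_head//= IH// => z zs.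
  by apply: sub; rewrite inE zs orbT.
have Gf p : G p <= f p + e * 3.
  have [y yD Uy] := DU (val p) (dot_val p).
  have Kf : restrict_sphere (K y) p <= f p + e * 3.
    by have := interior_subset Uy; rewrite /= retractK => /ltW.
  apply: le_trans Kf; rewrite /G.
  have : y \in enum_fset D by [].
  elim: (enum_fset D) => // z s IH; rewrite inE /= ge_min => /orP[/eqP ->|/IH ->].
    by rewrite lexx.
  by rewrite orbT.
have [q Hq] := AG e e0.
exists q => p; have := Hq p; have := fG p; have := Gf p; rewrite !ler_norml => ? ? /andP[? ?].
have e4 : e0' = e * 4 by rewrite /e; field.
by apply/andP; split; lra.
Qed.

End sphere_topology.

(** * The mean of a continuous function *)

Section mean.
Variables (R : realType) (m : nat) (hm : (1 <= m)%N).
Implicit Types (p r : usphere R m) (f g : usphere R m -> R) (q : mpoly m.+1 R).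
Local Notation homog d := (@ishomog1 m.+1 R d (@mdeg m.+1)).
Local Notation lam := (lambda R m).
Local Notation res := (@restrict_sphere R m).

Lemma lambda0 : lam 0 = 0. Proof. by rewrite /lambda mul0r. Qed.

Lemma lambda_gt0 k : (0 < k)%N -> 0 < lam k.
Proof.
move=> k0; rewrite /lambda mulr_gt0 ?ltr0n//.
have : 1 <= k%:R :> R by rewrite ler1n.
have : 1 <= m%:R :> R by rewrite ler1n.
by lra.
Qed.

Lemma lambda_ge0 k : 0 <= lam k.
Proof. by case: k => [|k]; [rewrite lambda0|exact/ltW/lambda_gt0]. Qed.

Lemma lambda_lt j k : (j < k)%N -> lam j < lam k.
Proof.
move=> jk; have m1 : 1 <= m%:R :> R by rewrite ler1n.
have : j%:R + 1 <= k%:R :> R by rewrite natr1 ler_nat.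
by have := ler0n R j; rewrite /lambda; nra.
Qed.

Lemma lambda_inj : injective lam.
Proof.
by move=> j k jk; case: (ltngtP j k) => // /lambda_lt; rewrite jk ltxx.
Qed.

Lemma harm_polyE k q : harm_poly R m k q <-> q \is homog k /\ Lap q = 0.
Proof. by []. Qed.

Lemma slap_harm k q p : harm_poly R m k q -> slap (res q) p = - lam k * res q p.
Proof.
move=> /harm_polyE[qk qh]; rewrite (slap_restrict _ qk) qh.
by rewrite [X in X - _](_ : _ = 0) ?sub0r ?mulNr//; exact: meval0.
Qed.

Lemma LapC0 : Lap (0 : mpoly m.+1 R) = 0.
Proof. by have := LapZ 0 (0 : mpoly m.+1 R); rewrite !scale0r. Qed.

Lemma harm0 k : harm_poly R m k 0.
Proof. by apply/harm_polyE; rewrite LapC0; split => //; exact: dhomog0. Qed.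

Lemma harm_lin k (c : R) q1 q2 : harm_poly R m k q1 -> harm_poly R m k q2 ->
  harm_poly R m k (q1 + c *: q2).
Proof.
move=> /harm_polyE[k1 h1] /harm_polyE[k2 h2]; apply/harm_polyE.
split; first by apply: homogD => //; exact: homogZ.
by rewrite LapD LapZ h1 h2 scaler0 addr0.
Qed.

Lemma harmC c : harm_poly R m 0 (mpolyC m.+1 c).
Proof.
have C0 : mpolyC m.+1 c \is homog 0.
  by rewrite -[mpolyC _ _]mulr1 mul_mpolyC; apply: homogZ; exact: dhomog1.
by apply/harm_polyE; split=> //; exact: (Lap_homog_le1 (leq0n 1) C0).
Qed.

(** * Finite harmonic expansions and their constant terms *)

(** A finite harmonic expansion; [N] is only a bound for the degrees and may be enlarged. *)
Definition hfam (h : nat -> mpoly m.+1 R) (N : nat) : Prop :=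
  (forall k, harm_poly R m k (h k)) /\ forall k, (N <= k)%N -> h k = 0.

Definition hsum (h : nat -> mpoly m.+1 R) (N : nat) p : R := \sum_(k < N) res (h k) p.

(** The component of degree 0 is constant on the sphere, and the pole serves to read off its
    value. *)
Definition hmean (h : nat -> mpoly m.+1 R) : R := res (h 0%N) (pole R m).

Lemma res_homog0 q p r : q \is homog 0 -> res q p = res q r.
Proof.
move=> q0; have E p' : res q p' = pev q 0.
  by rewrite -[LHS](mul1r) -(expr0 0) -[res q p']/(pev q (val p')) -pev_homog// scale0r.
by rewrite !E.
Qed.

Lemma hmeanE h N p : hfam h N -> res (h 0%N) p = hmean h.
Proof. by move=> [H _]; have [h0 _] := H 0%N; exact: res_homog0. Qed.

Lemma hfamW h N N' : (N <= N')%N -> hfam h N -> hfam h N'.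
Proof. by move=> NN [H Z]; split => // k Nk; apply: Z; exact: leq_trans NN Nk. Qed.

Lemma hsumW h N N' p : (N <= N')%N -> hfam h N -> hsum h N' p = hsum h N p.
Proof.
move=> NN [_ Z]; rewrite /hsum -!(big_mkord xpredT (fun k => res (h k) p)).
rewrite (big_cat_nat _ (n := N))//= [X in _ + X]big_nat_cond [X in _ + X]big1 ?addr0// => k.
by rewrite andbT => /andP[Nk _]; rewrite Z//; exact: meval0.
Qed.

Lemma hfam_lin h1 N1 h2 N2 c : hfam h1 N1 -> hfam h2 N2 ->
  exists2 h, hfam h (maxn N1 N2) &
    (forall p, hsum h (maxn N1 N2) p = hsum h1 N1 p + c * hsum h2 N2 p) /\
    hmean h = hmean h1 + c * hmean h2.
Proof.
move=> H1 H2; exists (fun k => h1 k + c *: h2 k).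
  split=> [k|k]; first by apply: harm_lin; [have [+ _] := H1|have [+ _] := H2].
  by rewrite geq_max => /andP[k1 k2]; rewrite H1.2// H2.2// scaler0 addr0.
split; last by rewrite /hmean restrictD restrictZ.
move=> p; rewrite -(hsumW p (leq_maxl N1 N2) H1) -(hsumW p (leq_maxr N1 N2) H2).
by rewrite /hsum mulr_sumr -big_split; apply: eq_bigr => k _; rewrite restrictD restrictZ.
Qed.

Lemma smooth_hsum h N : smooth_ext (hsum h N).
Proof.
have -> : hsum h N = res (\sum_(k < N) h k).
  by apply/funext => p; rewrite [RHS]pev_sum.
exact: smooth_ext_restrict.
Qed.

Lemma slap_hsum h N p : hfam h N -> slap (hsum h N) p = \sum_(k < N) - lam k * res (h k) p.
Proof.
move=> [H _]; elim: N => [|N IH].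
  rewrite (_ : hsum h 0 = cst 0) ?slap_cst ?big_ord0//.
  by apply/funext => r; rewrite /hsum big_ord0.
rewrite (_ : hsum h N.+1 = fun p => hsum h N p + res (h N) p); last first.
  by apply/funext => r; rewrite /hsum big_ord_recr.
rewrite slapD ?IH ?(slap_harm _ (H N)) ?big_ord_recr//; first exact: smooth_hsum.
exact: smooth_ext_restrict.
Qed.

(* The non-constant part of [hsum h N] is the Laplacian of some [hsum w N]; look at the maximum of
   [u + hsum w N]. *)
Lemma hmean_ge (u : usphere R m -> R) h N M : smooth_ext u -> hfam h N ->
  (forall p, M <= slap u p + hsum h N p) -> M <= hmean h.
Proof.
(* In degree 0 the inverse of [lam 0 = 0] is 0 by convention, so [w 0 = 0]. Passing from [N] to
   [N.+1] ensures that the sum has a term of degree 0. *)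
move=> su Hh0 HM0; pose w k : mpoly m.+1 R := (- (lam k)^-1) *: h k.
have Hh := hfamW (leqnSn N) Hh0.
have HM p : M <= slap u p + hsum h N.+1 p by rewrite (hsumW p (leqnSn N) Hh0).
have Hw : hfam w N.+1.
  split=> k; last by move=> Nk; rewrite /w Hh.2// scaler0.
  by rewrite /w -[_ *: _]add0r; apply: harm_lin; [exact: harm0|exact: Hh.1].
have suw : smooth_ext (fun p => u p + hsum w N.+1 p).
  by apply: smooth_extD => //; exact: smooth_hsum.
have [p pmax] := sphere_max (smooth_ext_cont suw).
have := slap_le0_at_max suw pmax.
rewrite slapD//; last exact: smooth_hsum.
rewrite (slap_hsum _ Hw) => L0.
have E : \sum_(k < N.+1) - lam k * res (w k) p = hsum h N.+1 p - hmean h.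
  rewrite /hsum !big_ord_recl/= (hmeanE p Hh) lambda0 oppr0 mul0r add0r addrAC subrr add0r.
  apply: eq_bigr => k _; rewrite restrictZ mulrA mulrNN mulfV ?mul1r// gt_eqF//.
  exact: lambda_gt0.
by have := HM p; move: L0; rewrite E; lra.
Qed.

Lemma hmean_le (u : usphere R m -> R) h N M : smooth_ext u -> hfam h N ->
  (forall p, slap u p + hsum h N p <= M) -> hmean h <= M.
Proof.
move=> su Hh HM.
have Z : hfam (fun=> 0) 0 by split => // k; exact: harm0.
have [h' Hh' [E1 E2]] := hfam_lin (-1) Z Hh.
have H := @hmean_ge (fun p => (-1) * u p) h' _ (- M) (smooth_extZ (-1) su) Hh'.
have hm0 : hmean (fun=> 0) = 0 by exact: meval0.
move: H; rewrite E2 hm0 add0r mulN1r lerN2; apply => p.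
rewrite slapZ// E1 /hsum big_ord0 add0r -/(hsum h N p) !mulN1r -opprD lerN2.
exact: HM.
Qed.

(** * The mean as a positive linear functional *)

(** A lower integral with harmonic expansions below [f] as test functions; on continuous functions
    it is determined by [mean_near]. *)
Definition mean f : R :=
  sup [set c | exists h N, [/\ hfam h N, hmean h = c & forall p, hsum h N p <= f p]].

(** By the maximum principle an expansion below [f] has mean at most [hmean h + e], and [h] lowered
    by the constant [e] is such an expansion. *)
Lemma mean_near f h N e : hfam h N -> (forall p, `|f p - hsum h N p| <= e) ->
  `|mean f - hmean h| <= e.
Proof.
move=> Hh He; rewrite ler_distl /mean; set A := [set c | _].
have Ale c : A c -> c <= hmean h + e.
  move=> [h' [N' [Hh' <- hf]]].
  have [d Hd [D1 D2]] := hfam_lin (-1) Hh' Hh.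
  have H := @hmean_le (cst 0) d _ e (@smooth_ext_cst R m 0) Hd.
  have : hmean d <= e.
    apply: H => p; rewrite slap_cst add0r D1.
    by have := hf p; have := He p; rewrite ler_norml => /andP[_]; lra.
  by rewrite D2; lra.
have Ah : A (hmean h - e).
  have [d Hd [D1 D2]] : exists2 d, hfam d (maxn N 1) &
      (forall p, hsum d (maxn N 1) p = hsum h N p + (- e) * 1) /\ hmean d = hmean h + (- e) * 1.
    have H1 : hfam (fun k => if k is 0 then mpolyC m.+1 1 else 0) 1.
      by split=> [[|k]|[|k]]//; [exact: harmC|exact: harm0].
    have [d Hd [D1 D2]] := hfam_lin (- e) Hh H1; exists d => //.
    split=> [p|]; last by rewrite D2 /hmean restrictC.
    by rewrite D1 [hsum _ 1 p]big_ord1 restrictC.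
  exists d, (maxn N 1); split => //; first by rewrite D2 mulr1.
  move=> p; rewrite D1 mulr1.
  by have := He p; rewrite ler_norml => /andP[+ _]; lra.
have supA : has_sup A by split; [exists (hmean h - e)|exists (hmean h + e) => c /Ale].
apply/andP; split; first exact: sup_ubound supA.2 _ Ah.
by apply: sup_le_ub => //; exists (hmean h - e).
Qed.

Lemma mean_hsum h N : hfam h N -> mean (hsum h N) = hmean h.
Proof.
move=> Hh; apply/eqP; rewrite -subr_eq0 -normr_le0.
by apply: (mean_near Hh) => p; rewrite subrr normr0.
Qed.

Definition hexp f : Prop := exists h N, hfam h N /\ f = hsum h N.

Lemma hexp_lin f g c : hexp f -> hexp g -> hexp (fun p => f p + c * g p).
Proof.
move=> [h1 [N1 [H1 ->]]] [h2 [N2 [H2 ->]]].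
have [h Hh [E _]] := hfam_lin c H1 H2.
by exists h, (maxn N1 N2); split => //; apply/funext => p; rewrite E.
Qed.

Lemma hfam1 k q : harm_poly R m k q -> hfam (fun j => if j == k then q else 0) k.+1.
Proof.
move=> kq; split=> j; first by case: eqP => [->//|_]; exact: harm0.
by case: eqP => // ->; rewrite ltnn.
Qed.

Lemma hsum1 k q p : hsum (fun j => if j == k then q else 0) k.+1 p = res q p.
Proof.
rewrite /hsum big_ord_recr/= eqxx big1 ?add0r// => j _.
by rewrite ltn_eqF//; exact: meval0.
Qed.

Lemma res_sqn p : res (sqn R m.+1) p = 1.
Proof.
rewrite -[LHS]/(pev (sqn R m.+1) (val p)) pev_sum; apply: etrans (dot_val p).
by apply: eq_bigr => i _; rewrite expr2 pevM pevX.
Qed.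

(** [harmonic_split] is iterated on the cofactor of [sqn]; on the sphere [sqn] is 1, so the harmonic
    parts simply add up. *)
Lemma homog_hexp d q : q \is homog d -> exists2 h, hfam h d.+1 & res q = hsum h d.+1.
Proof.
elim/ltn_ind : d q => d IH q qd.
have low : (d <= 1)%N -> exists2 h, hfam h d.+1 & res q = hsum h d.+1.
  move=> d1; have kq : harm_poly R m d q by split => //; exact: Lap_homog_le1 qd.
  by exists (fun j => if j == d then q else 0); [exact: hfam1|apply/funext => p; rewrite hsum1].
have [//|d2] := leqP d 1.
have [d' dE] : exists d', d = d'.+2 by exists d.-2; lia.
subst d.
have [h [r [hd hL rd qE]]] := harmonic_split qd.
have [h2 H2 E2] := IH d' (ltnW (ltnSn _)) r rd.
have kh : harm_poly R m d'.+2 h by [].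
have [h' Hh' [E' _]] := hfam_lin 1 (hfam1 kh) H2.
have M : maxn d'.+3 d'.+1 = d'.+3 by lia.
rewrite M in Hh' E'; exists h' => //; apply/funext => p.
by rewrite E' hsum1 mul1r -E2 qE restrictD restrictM res_sqn mul1r.
Qed.

Lemma restrict_hexp q : hexp (res q).
Proof.
have Z : hexp (fun=> 0).
  exists (fun=> 0), 0%N; split; first by split => // k; exact: harm0.
  by apply/funext => p; rewrite /hsum big_ord0.
have -> : res q = fun p => \sum_(k <- msupp q) mcoeff k q * res (mpolyX R k) p.
  apply/funext => p; rewrite {1}(mpolyE q) -[LHS]/(pev _ (val p)) pev_sum.
  by apply: eq_bigr => k _; rewrite pevZ.
elim: (msupp q) => [|k s IH].
  by rewrite (_ : (fun p => _) = fun=> 0)//; apply/funext => p; rewrite big_nil.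
have Hk : hexp (res (mpolyX R k)).
  have kh : mpolyX R k \is homog (mdeg k) by rewrite dhomogX.
  by have [h Hh E] := homog_hexp kh; exists h, (mdeg k).+1.
have := hexp_lin (mcoeff k q) IH Hk.
by congr hexp; apply/funext => p; rewrite big_cons addrC.
Qed.

Lemma hexp_dense f e : sphere_cont f -> 0 < e ->
  exists h N, hfam h N /\ forall p, `|f p - hsum h N p| <= e.
Proof.
move=> cf e0; have [q Hq] := sphere_weierstrass cf e0.
by have [h [N [Hh E]]] := restrict_hexp q; exists h, N; split => // p; rewrite -E.
Qed.

(** [hmean] is linear on expansions, and [mean_near] transfers this through approximations of [f]
    and [g]. *)
Lemma mean_lin f g c : sphere_cont f -> sphere_cont g ->
  mean (fun p => f p + c * g p) = mean f + c * mean g.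
Proof.
move=> cf cg; apply/eqP; rewrite -subr_eq0 -normr_le0; apply/ler_addgt0Pr => e e0; rewrite add0r.
have c1 : 0 < 2 * (1 + `|c|) by rewrite mulr_gt0// ltr_wpDr.
(* The total error is [d] for [f], [|c| * d] for [g] and [d + |c| * d] for the combination. *)
pose d := e / (2 * (1 + `|c|)); have d0 : 0 < d by rewrite divr_gt0.
have eE : e = 2 * d + 2 * (`|c| * d) by rewrite /d; field; rewrite gt_eqF//; move: c1; lra.
have [h1 [N1 [H1 F1]]] := hexp_dense cf d0.
have [h2 [N2 [H2 F2]]] := hexp_dense cg d0.
have [h Hh [E1 E2]] := hfam_lin c H1 H2.
have n1 := mean_near H1 F1; have n2 := mean_near H2 F2.
have n3 : `|mean (fun p => f p + c * g p) - hmean h| <= d + `|c| * d.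
  apply: (mean_near Hh) => p; rewrite E1.
  rewrite (_ : _ - _ = (f p - hsum h1 N1 p) + c * (g p - hsum h2 N2 p)); last by ring.
  by rewrite (le_trans (ler_normD _ _))// normrM lerD// ler_wpM2l.
rewrite E2 in n3.
rewrite (_ : _ - _ = (mean (fun p => f p + c * g p) - (hmean h1 + c * hmean h2))
  - (mean f - hmean h1) - c * (mean g - hmean h2)); last by ring.
apply: le_trans (ler_normB _ _) _; rewrite normrM.
have := ler_normB (mean (fun p => f p + c * g p) - (hmean h1 + c * hmean h2)) (mean f - hmean h1).
have := ler_wpM2l (normr_ge0 c) n2.
by rewrite eE; lra.
Qed.

Lemma mean_norm_le f M : (forall p, `|f p| <= M) -> `|mean f| <= M.
Proof.
move=> fM; have Z : hfam (fun=> 0) 0 by split => // k; exact: harm0.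
have := @mean_near f _ _ M Z; rewrite (_ : hmean (fun=> 0) = 0) ?subr0; last exact: meval0.
by apply => p; rewrite /hsum big_ord0 subr0.
Qed.

Lemma mean_cst c : mean (fun=> c) = c.
Proof.
have H := hfam1 (harmC c).
rewrite (_ : (fun=> c) = hsum (fun j => if j == 0%N then mpolyC m.+1 c else 0) 1).
  by rewrite (mean_hsum H) /hmean eqxx restrictC.
by apply/funext => p; rewrite hsum1 restrictC.
Qed.

(** If [0 <= f <= M], then [f - M / 2] is bounded by [M / 2] in absolute value, and so is its
    mean. *)
Lemma mean_ge0 f : sphere_cont f -> (forall p, 0 <= f p) -> 0 <= mean f.
Proof.
move=> cf f0; have [M M0 HM] := sphere_bound cf.
have : `|mean (fun p => f p + (-1) * (M / 2))| <= M / 2.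
  apply: mean_norm_le => p; have := f0 p; have := HM p.
  by rewrite !ler_norml => /andP[_ ?] ?; apply/andP; split; lra.
rewrite mean_lin//; last exact: sphere_cont_cst.
by rewrite mean_cst ler_norml => /andP[+ _]; lra.
Qed.

Lemma meanZ c f : sphere_cont f -> mean (fun p => c * f p) = c * mean f.
Proof.
move=> cf; have := mean_lin c (@sphere_cont_cst R m 0) cf.
by rewrite mean_cst add0r => <-; congr mean; apply/funext => p; rewrite add0r.
Qed.

Lemma mean_le f g : sphere_cont f -> sphere_cont g -> (forall p, f p <= g p) -> mean f <= mean g.
Proof.
move=> cf cg fg; have := mean_lin (-1) cg cf; rewrite mulN1r => E.
rewrite -subr_ge0 -E; apply: mean_ge0; first exact: sphere_contD cg (sphere_contZ cf).
by move=> p; rewrite mulN1r subr_ge0.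
Qed.

Lemma sphere_cont_sum (I : Type) (s : seq I) (F : I -> usphere R m -> R) :
  (forall i, sphere_cont (F i)) -> sphere_cont (fun p => \sum_(i <- s) F i p).
Proof.
move=> cF; elim: s => [|i s IH].
  have -> : (fun p : usphere R m => \sum_(i <- [::]) F i p) = fun=> 0.
    by apply/funext => p; rewrite big_nil.
  exact: sphere_cont_cst.
have -> : (fun p => \sum_(j <- i :: s) F j p) = fun p => F i p + \sum_(j <- s) F j p.
  by apply/funext => p; rewrite big_cons.
exact: sphere_contD (cF i) IH.
Qed.

Lemma mean_sum (I : Type) (s : seq I) (F : I -> usphere R m -> R) :
  (forall i, sphere_cont (F i)) ->
  mean (fun p => \sum_(i <- s) F i p) = \sum_(i <- s) mean (F i).
Proof.
move=> cF; elim: s => [|i s IH].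
  have -> : (fun p : usphere R m => \sum_(i <- [::]) F i p) = fun=> 0.
    by apply/funext => p; rewrite big_nil.
  by rewrite mean_cst big_nil.
have -> : (fun p => \sum_(j <- i :: s) F j p) = fun p => F i p + 1 * \sum_(j <- s) F j p.
  by apply/funext => p; rewrite big_cons mul1r.
by rewrite mean_lin// ?IH ?big_cons ?mul1r//; exact: sphere_cont_sum.
Qed.

(** If the expansion [h] approximates [slap u], then [h] plus the Laplacian of [- u] is small, and
    [hmean_ge] and [hmean_le] bound [hmean h]. *)
Lemma mean_slap u : smooth_ext u -> mean (slap u) = 0.
Proof.
move=> su; apply/eqP; rewrite -normr_le0; apply/ler_addgt0Pr => e e0; rewrite add0r.
have [h [N [Hh He]]] := hexp_dense (smooth_ext_cont (slap_ext su)) (divr_gt0 e0 (ltr0n R 2)).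
have n1 := mean_near Hh He.
have su' := smooth_extZ (-1) su.
have H p : - (e / 2) <= slap (fun p => -1 * u p) p + hsum h N p <= e / 2.
  by have := He p; rewrite slapZ// ler_norml => /andP[? ?]; apply/andP; split; lra.
have [n2 n3] : - (e / 2) <= hmean h /\ hmean h <= e / 2.
  split; [apply: (hmean_ge su' Hh)|apply: (hmean_le su' Hh)] => p; by have /andP[] := H p.
by move: n1; rewrite !ler_norml => /andP[? ?]; apply/andP; split; lra.
Qed.

(** * Orthogonality of different degrees and symmetry of the Laplacian *)

Lemma harm_mderiv k i q : harm_poly R m k q -> harm_poly R m k.-1 (mderiv i q).
Proof.
move=> /harm_polyE[qk qL]; apply/harm_polyE; split; first exact: homog_mderiv.
rewrite /Lap (eq_bigr (fun j => mderiv i (mderiv j (mderiv j q)))) => [|j _].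
  by rewrite -raddf_sum -/(Lap q) qL raddf0.
by rewrite (mderiv_comm i j q) (mderiv_comm i j (mderiv j q)).
Qed.

Lemma mean_harm0 k q : (0 < k)%N -> harm_poly R m k q -> mean (res q) = 0.
Proof.
move=> k0 kq; have := mean_slap (smooth_ext_restrict q).
have -> : slap (res q) = fun p => - lam k * res q p by apply/funext => p; exact: slap_harm.
rewrite meanZ; last exact: sphere_cont_restrict.
move=> /eqP; rewrite mulf_eq0 oppr_eq0 => /orP[/eqP l0|/eqP//].
by have := lambda_gt0 k0; rewrite l0 ltxx.
Qed.

(** A factor of degree 0 is constant, and the other one then has mean 0. Otherwise the gradient term
    in the Laplacian of the product has mean 0 by induction, the degrees dropping by one each, and
    the positive factor [lam (j + k)] can be cancelled. *)
Lemma harm_orthogonal j k q1 q2 : j != k -> harm_poly R m j q1 -> harm_poly R m k q2 ->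
  mean (fun p => res q1 p * res q2 p) = 0.
Proof.
elim: j k q1 q2 => [|j IH] [|k] q1 q2 jk j1 k2 //.
- have [q10 _] := j1; rewrite (_ : (fun p => _) = fun p => res q1 (pole R m) * res q2 p).
    by rewrite meanZ ?(mean_harm0 _ k2) ?mulr0//; exact: sphere_cont_restrict.
  by apply/funext => p; rewrite (res_homog0 p (pole R m) q10).
- have [q20 _] := k2; rewrite (_ : (fun p => _) = fun p => res q2 (pole R m) * res q1 p).
    by rewrite meanZ ?(mean_harm0 _ j1) ?mulr0//; exact: sphere_cont_restrict.
  by apply/funext => p; rewrite (res_homog0 p (pole R m) q20) mulrC.
have := mean_slap (smooth_ext_restrict (q1 * q2)).
have hom : q1 * q2 \is homog (j.+1 + k.+1) by apply: dhomogM; [exact: j1.1|exact: k2.1].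
have LM : Lap (q1 * q2) = (\sum_i mderiv i q1 * mderiv i q2) *+ 2.
  have /harm_polyE[_ L1] := j1; have /harm_polyE[_ L2] := k2.
  by rewrite LapM L1 L2 mul0r mulr0 add0r addr0.
pose D i p := res (mderiv i q1) p * res (mderiv i q2) p.
have cD i : sphere_cont (D i) by apply: sphere_contM; exact: sphere_cont_restrict.
have -> : slap (res (q1 * q2)) = fun p =>
    (- lam (j.+1 + k.+1)) * (res q1 p * res q2 p) + 2 * \sum_i D i p.
  apply/funext => p; rewrite (slap_restrict _ hom) restrictM mulNr addrC; congr (_ + _).
  rewrite LM -scaler_nat restrictZ -[res _ p]/(pev _ (val p)) pev_sum; congr (_ * _).
  by apply: eq_bigr => i _; rewrite pevM.
have cM : sphere_cont (fun p => res q1 p * res q2 p).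
  by apply: sphere_contM; exact: sphere_cont_restrict.
have cS : sphere_cont (fun p => \sum_i D i p) by exact: sphere_cont_sum.
have MS : mean (fun p => \sum_i D i p) = 0.
  rewrite mean_sum// big1// => i _.
  exact: (IH k _ _ _ (harm_mderiv i j1) (harm_mderiv i k2)).
rewrite mean_lin ?meanZ ?MS ?mulr0 ?addr0//; last exact: sphere_contZ.
move=> /eqP; rewrite mulf_eq0 oppr_eq0 => /orP[/eqP l0|/eqP//].
by have := @lambda_gt0 (j.+1 + k.+1) isT; rewrite l0 ltxx.
Qed.

(* Choose a polynomial v with slap v - v close to slap f - f: by the maximum principle f - v, hence
   also slap (f - v), is small. *)
Lemma mean_slap_harm f k q : smooth_ext f -> harm_poly R m k q ->
  mean (fun p => slap f p * res q p) = - lam k * mean (fun p => f p * res q p).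
Proof.
move=> sf kq; have cq := @sphere_cont_restrict R m q.
have sLf := slap_ext sf.
have cf := smooth_ext_cont sf; have cLf := smooth_ext_cont sLf.
have [B B0 HB] := sphere_bound cq.
apply/eqP; rewrite -subr_eq0 -normr_le0; apply/ler_addgt0Pr => e e0; rewrite add0r.
have l0 := lambda_ge0 k.
have c1 : 0 < (2 + lam k) * B by rewrite mulr_gt0//; lra.
(* The final estimate is [|slap w + lam k * w| <= |slap w - w| + (1 + lam k) * |w|], at most
   [(2 + lam k) * d], times the bound [B] of [res q]. *)
pose d := e / ((2 + lam k) * B); have d0 : 0 < d by rewrite divr_gt0.
have eE : e = (2 + lam k) * d * B.
  by rewrite /d; field; rewrite !gt_eqF//; lra.
have sF : smooth_ext (fun p => slap f p + (-1) * f p).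
  by apply: smooth_extD => //; exact: smooth_extZ.
have [h [N [Hh Nh]]] := hexp_dense (smooth_ext_cont sF) d0.
(* Subtracting the identity from [slap] multiplies the part of degree [j] by [- (1 + lam j)], which
   is never 0. *)
pose v j : mpoly m.+1 R := (- (1 + lam j)^-1) *: h j.
have Hv : hfam v N.
  split=> j; last by move=> Nj; rewrite /v Hh.2// scaler0.
  by rewrite /v -[_ *: _]add0r; apply: harm_lin; [exact: harm0|exact: Hh.1].
have vE p : slap (hsum v N) p - hsum v N p = hsum h N p.
  rewrite (slap_hsum _ Hv) /hsum -sumrB; apply: eq_bigr => j _.
  rewrite restrictZ; have := lambda_ge0 j => lj; field.
  by rewrite gt_eqF//; lra.
pose w p := f p + (-1) * hsum v N p.
have sv : smooth_ext (hsum v N) by exact: smooth_hsum.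
have sw : smooth_ext w by apply: smooth_extD => //; exact: smooth_extZ.
have LwE p : slap w p = slap f p + (-1) * slap (hsum v N) p by rewrite /w slap_lin.
have res1 p : `|slap w p - w p| <= d.
  have E : slap w p - w p = slap f p + (-1) * f p - hsum h N p.
    by rewrite LwE /w -vE; move: (slap f p) (slap _ p) (f p) (hsum v N p) => *; ring.
  by rewrite E.
(* At a maximum of [w] the Laplacian is nonpositive, so [w <= - (slap w - w) <= d] there; minima are
   symmetric. *)
have w_small p : `|w p| <= d.
  have [a wa] := sphere_max (smooth_ext_cont sw).
  have [b wb] := sphere_min (smooth_ext_cont sw).
  have La := slap_le0_at_max sw wa.
  have Lb : 0 <= slap w b.
    have : slap (fun p => (-1) * w p) b <= 0.
      by apply: (slap_le0_at_max (smooth_extZ (-1) sw)) => r; rewrite !mulN1r lerN2.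
    by rewrite slapZ// mulN1r oppr_le0.
  have := res1 a; have := res1 b; rewrite !ler_norml => /andP[? ?] /andP[? ?].
  by apply/andP; split; [have := wb p|have := wa p]; lra.
(* Applying [slap + lam k] removes the component of degree [k], and the others are orthogonal to
   [q]. *)
have vorth : mean (fun p => (slap (hsum v N) p + lam k * hsum v N p) * res q p) = 0.
  pose T (j : 'I_N) p := (lam k - lam j) * (res (v j) p * res q p).
  rewrite (_ : (fun p => _) = fun p => \sum_(j < N) T j p); last first.
    apply/funext => p; rewrite (slap_hsum _ Hv) /hsum.
    rewrite [lam k * _]mulr_sumr -big_split/= [LHS]mulr_suml.
    by apply: eq_bigr => j _; rewrite /T; ring.
  have cvq (j : 'I_N) : sphere_cont (fun p => res (v j) p * res q p).
    by apply: sphere_contM; exact: sphere_cont_restrict.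
  rewrite mean_sum => [|j]; last exact: sphere_contZ.
  rewrite big1// => j _; rewrite meanZ//.
  have [->|jk] := eqVneq (val j) k; first by rewrite subrr mul0r.
  by rewrite (harm_orthogonal jk (Hv.1 j) kq) mulr0.
have small : `|mean (fun p => (slap w p + lam k * w p) * res q p)| <= e.
  apply: mean_norm_le => p; rewrite normrM eE; apply: ler_pM => //.
  apply: le_trans (ler_normD _ _) _; rewrite normrM (ger0_norm l0).
  have := ler_wpM2l l0 (w_small p).
  have := ler_normD (slap w p - w p) (w p); rewrite subrK.
  by have := res1 p; have := w_small p; lra.
apply: le_trans small.
have cv := smooth_ext_cont sv; have cLv := smooth_ext_cont (slap_ext sv).
have cfq := sphere_contM cf cq; have cLfq := sphere_contM cLf cq.
have cvv : sphere_cont (fun p => (slap (hsum v N) p + lam k * hsum v N p) * res q p).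
  exact: (sphere_contM (sphere_contD cLv (sphere_contZ cv)) cq).
have E : (fun p => (slap w p + lam k * w p) * res q p) =
   fun p => (slap f p * res q p + lam k * (f p * res q p)) +
     (-1) * ((slap (hsum v N) p + lam k * hsum v N p) * res q p).
  apply/funext => p; rewrite LwE /w.
  move: (slap f p) (slap _ p) (f p) (hsum v N p) (res q p) => *; ring.
rewrite E (mean_lin _ (sphere_contD cLfq (sphere_contZ (c := lam k) cfq)) cvv).
by rewrite vorth mulr0 addr0 mean_lin// mulNr opprK.
Qed.

(** * Moments of linear forms and strict positivity of the mean *)

Definition linform (a : 'rV[R]_m.+1) : mpoly m.+1 R := \sum_i a 0 i *: mpolyX R (mnm1 i).

Lemma res_linform a p : res (linform a) p = dot (val p) a.
Proof.
rewrite -[LHS]/(pev _ (val p)) pev_sum; apply: eq_bigr => i _.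
by rewrite pevZ pevX mulrC.
Qed.

Lemma homog_linform a : linform a \is homog 1.
Proof. by apply: homog_sum => i; apply: homogZ; exact: homog_var. Qed.

Lemma mderiv_linform a i d :
  mderiv i (linform a ^+ d) = (d%:R * a 0 i) *: linform a ^+ d.-1.
Proof.
have D1 : mderiv i (linform a) = mpolyC m.+1 (a 0 i).
  rewrite /linform raddf_sum/= (bigD1 i)//= big1 ?addr0 => [|j ji].
    by rewrite mderivZ mderiv_var eqxx -mul_mpolyC mulr1.
  by rewrite mderivZ mderiv_var eq_sym (negPf ji) scaler0.
elim: d => [|d IH]; first by rewrite expr0 mul0r scale0r -mpolyC1 mderivC.
rewrite exprS mderivM D1 IH mul_mpolyC -scalerAr.
case: d {IH} => [|d]; first by rewrite !mul0r scale0r addr0 expr0 mul1r.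
by rewrite /= -exprS -scalerDl -[d.+2%:R]natr1; congr (_ *: _); ring.
Qed.

Lemma Lap_linform a d : Lap (linform a ^+ d.+2) = ((d.+2 * d.+1)%:R * dot a a) *: linform a ^+ d.
Proof.
rewrite /Lap (eq_bigr (fun i => ((d.+2 * d.+1)%:R * (a 0 i * a 0 i)) *: linform a ^+ d)).
  by rewrite -scaler_suml -mulr_sumr.
move=> i _; rewrite mderiv_linform mderivZ mderiv_linform scalerA /=; congr (_ *: _).
by rewrite natrM; ring.
Qed.

(** The Laplacian of the power [d + 2] of the linear form has mean 0; its terms carry the factors
    [(d + 2) (d + 1)] and [- (d + 2) (m + d + 1)], from which [d + 2] is cancelled. *)
Lemma moment_rec r d :
  (m%:R + d%:R + 1) * mean (res (linform (val r) ^+ d.+2)) =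
  (d%:R + 1) * mean (res (linform (val r) ^+ d)).
Proof.
have hom : linform (val r) ^+ d.+2 \is homog d.+2.
  by have := dhomogMn d.+2 (homog_linform (val r)); rewrite mul1n.
have cr (q : mpoly m.+1 R) : sphere_cont (res q) by exact: sphere_cont_restrict.
have := mean_slap (smooth_ext_restrict (linform (val r) ^+ d.+2)).
have -> : slap (res (linform (val r) ^+ d.+2)) = fun p =>
   (- lam d.+2) * res (linform (val r) ^+ d.+2) p + (d.+2 * d.+1)%:R * res (linform (val r) ^+ d) p.
  apply/funext => p; rewrite (slap_restrict _ hom) Lap_linform dot_val mulr1 restrictZ.
  by rewrite addrC mulNr.
rewrite mean_lin ?meanZ//; last exact: sphere_contZ.
rewrite /lambda natrM -[d.+2%:R]natr1 -natr1 => H.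
have d2 : d%:R + 1 + 1 != 0 :> R by rewrite !natr1 pnatr_eq0.
apply: (mulfI d2); apply/eqP; rewrite -subr_eq0 -oppr_eq0; apply/eqP; rewrite -H; ring.
Qed.

Lemma moment0 r : mean (res (linform (val r) ^+ 0)) = 1.
Proof.
rewrite -[RHS]mean_cst; congr mean; apply/funext => p.
by rewrite expr0 -mpolyC1 restrictC.
Qed.

Lemma moment_odd r j : mean (res (linform (val r) ^+ j.*2.+1)) = 0.
Proof.
elim: j => [|j IH].
  rewrite expr1; apply: (@mean_harm0 1) => //; apply/harm_polyE.
  by split; [exact: homog_linform|exact: (@Lap_homog_le1 _ _ 1 _ isT (homog_linform _))].
have := moment_rec r j.*2.+1; rewrite IH mulr0 => /eqP; rewrite mulf_eq0 => /orP[|/eqP//].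
by rewrite -natrD natr1 pnatr_eq0.
Qed.

(** The ratios [a (j + 1) / a j] tend to 1, so from some [J] on they are at least [k = (1 + z) / 2],
    which is larger than [z]. *)
Lemma ratio_growth (a : nat -> R) (M z c : R) : 0 <= M -> 0 < z -> z < 1 -> 0 < c ->
  0 < a 0%N -> (forall j, (M + j.*2%:R + 1) * a j.+1 = (j.*2%:R + 1) * a j) ->
  exists j, z ^+ j < c * a j.
Proof.
move=> M0 z0 z1 c0 a0 rec.
have apos j : 0 < a j.
  elim: j => // j IH.
  have P1 : 0 < M + j.*2%:R + 1 by have := ler0n R j.*2; lra.
  by rewrite -(pmulr_rgt0 _ P1) rec mulr_gt0// ltr_wpDl.
pose k := (1 + z) / 2.
have kE : k * 2 = 1 + z by rewrite /k; field.
have k0 : 0 < k by lra.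
have k1 : 0 < 1 - k by lra.
(* For [j >= J] one has [M * k <= j * (1 - k)], which makes the ratio [(2 j + 1) / (M + 2 j + 1)] at
   least [k]. *)
pose J := (Num.bound (M * k / (1 - k))).
have grow j : (J <= j)%N -> k * a j <= a j.+1.
  move=> Jj; have P1 : 0 < M + j.*2%:R + 1 by have := ler0n R j.*2; lra.
  rewrite -(ler_pM2l P1) rec mulrA ler_wpM2r ?(ltW (apos j))//.
  have : M * k <= j%:R * (1 - k).
    rewrite -ler_pdivrMr//; apply: le_trans (_ : J%:R <= _); last by rewrite ler_nat.
    by apply/ltW/archi_boundP/divr_ge0; [exact: mulr_ge0 M0 (ltW k0)|exact: ltW].
  have : 0 <= j%:R * (1 - k) by rewrite mulr_ge0// ltW.
  rewrite -muln2 natrM; lra.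
have growi i : k ^+ i * a J <= a (J + i)%N.
  elim: i => [|i IH]; first by rewrite expr0 mul1r addn0.
  rewrite addnS exprS -mulrA; apply: le_trans (grow _ (leq_addr _ _)).
  by rewrite ler_wpM2l// ltW.
pose y := z / k.
have y1 : y < 1 by rewrite ltr_pdivrMr// mul1r; lra.
have y0 : 0 <= y by rewrite divr_ge0// ltW.
have caJ : 0 < c * a J / 2 by rewrite divr_gt0// mulr_gt0.
have [i yi] := expr_small y0 y1 caJ.
exists (J + i)%N; rewrite exprD.
apply: (@lt_le_trans _ _ (c * (k ^+ i * a J))); last by rewrite ler_wpM2l// ltW.
have -> : z ^+ i = y ^+ i * k ^+ i by rewrite -exprMn /y divfK// gt_eqF.
have ki : 0 < k ^+ i by rewrite exprn_gt0.
have zJ : z ^+ J <= 1 by rewrite exprn_ile1// ltW.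
have yi0 : 0 <= y ^+ i by rewrite exprn_ge0.
rewrite mulrA [c * _]mulrCA [ltRHS]mulrC ltr_pM2r//.
apply: le_lt_trans (_ : y ^+ i < _); first by rewrite ler_piMl.
by apply: le_lt_trans yi _; lra.
Qed.

(** Suppose [v r > 0], so that [v >= c > 0] near [r]. With [t] the scalar product with [r], the
    polynomial [c (t ^ (2 N) (eta + t) / 2 - eta ^ (2 N))] lies below [v] everywhere. Since odd
    moments vanish, its mean is [c (eta / 2 * a N - eta ^ (2 N))], which is positive for some [N] by
    the slow decay of the even moments [a]. *)
Lemma mean_eq0 v : sphere_cont v -> (forall p, 0 <= v p) -> mean v = 0 -> forall p, v p = 0.
Proof.
move=> cv v0 mv r; apply/eqP; apply: contraT => vr.
have {vr}vr : 0 < v r by rewrite lt_neqAle eq_sym vr v0.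
pose c := v r / 2; have c0 : 0 < c by rewrite divr_gt0.
have cE : c * 2 = v r by rewrite /c; field.
have /cvgrPdist_lt/(_ _ c0)/nbhs_ballP[d /= d0 Hd] := cv r.
have Hd' p : `|val p - val r| < d -> c <= v p.
  move=> pd; have : ball (val r) d (val p) by rewrite -ball_normE/= distrC.
  by move=> /Hd; rewrite /= !retractK ltr_norml => /andP[_]; lra.
(* If [t >= eta], the squared Euclidean distance to [r] is [2 - 2 t <= d ^ 2 / 2], so the point lies
   where [v >= c]; the bound [1 / 2] keeps [eta] positive. *)
pose eta : R := Num.max (2^-1) (1 - d ^+ 2 / 4).
have dd : 0 < d ^+ 2 by rewrite exprn_gt0.
have eta2 : 2^-1 <= eta by rewrite le_max lexx.
have etad : 1 - d ^+ 2 / 4 <= eta by rewrite le_max lexx orbT.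
have eta1 : eta < 1 by rewrite gt_max; apply/andP; split; lra.
pose t p := dot (val p) (val r).
have tD p (s : R) : dot (val p + s *: val r) (val p + s *: val r) = 1 + 2 * s * t p + s ^+ 2.
  rewrite dotDl dotZl [dot (val p) _]dotC [dot (val r) (_ + _)]dotC !dotDl !dotZl !dot_val.
  by rewrite [dot (val r) (val p)]dotC /t; ring.
have t1 p : - 1 <= t p <= 1.
  have := dot_ge0 (val p + 1 *: val r); have := dot_ge0 (val p + (-1) *: val r).
  by rewrite !tD => ? ?; apply/andP; split; lra.
(* For [t <= - eta] the first term is nonpositive; for [|t| < eta] it is at most [eta ^ (2 N)]; for
   [t >= eta] the bracket is at most 1 and [v >= c]. *)
have low N p : c * ((t p ^+ 2) ^+ N * (eta + t p) / 2 - (eta ^+ 2) ^+ N) <= v p.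
  have eN : 0 <= (eta ^+ 2) ^+ N by rewrite !exprn_ge0//; lra.
  have tN : 0 <= (t p ^+ 2) ^+ N by rewrite exprn_ge0// sqr_ge0.
  have /andP[tm tp] := t1 p.
  have [te|et] := ltP (t p) eta.
    apply: le_trans (v0 p); rewrite pmulr_rle0// subr_le0.
    have [tle|tgt] := leP (t p) (- eta).
      by apply: le_trans eN; rewrite -mulrA mulr_ge0_le0//; lra.
    have tN2 : (t p ^+ 2) ^+ N <= (eta ^+ 2) ^+ N.
      rewrite lerXn2r ?nnegrE ?sqr_ge0//.
      by rewrite -[t p ^+ 2]real_normK ?num_real// lerXn2r ?nnegrE ?ler_norml//; lra.
    rewrite -mulrA; apply: le_trans tN2; rewrite ler_piMr//; lra.
  apply: le_trans (_ : c <= _).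
    rewrite ger_pMr//.
    have : (t p ^+ 2) ^+ N <= 1 by rewrite exprn_ile1 ?sqr_ge0// expr_le1 ?[0 <= _](_ : _)//; lra.
    by move=> tN1; have : (t p ^+ 2) ^+ N * (eta + t p) <= 1 * 2 by [rewrite ler_pM//; lra]; lra.
  apply: Hd'; rewrite -(@ltr_pXn2r _ 2) ?nnegrE ?(ltW d0)//.
  apply: le_lt_trans (norm_sqr_le_dot _) _.
  by rewrite -[val p - _]/(val p + - _) -scaleN1r tD; lra.
pose a j := mean (res (linform (val r) ^+ j.*2)).
have rec j : (m%:R + j.*2%:R + 1) * a j.+1 = (j.*2%:R + 1) * a j by exact: moment_rec.
have a0 : 0 < a 0%N by rewrite /a moment0.
have z0 : 0 < eta ^+ 2 by rewrite exprn_gt0//; lra.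
have z1 : eta ^+ 2 < 1 by rewrite expr_lt1//; lra.
have [N HN] := ratio_growth (ler0n R m) z0 z1 (ltac:(lra) : 0 < eta / 2) a0 rec.
have cr (q : mpoly m.+1 R) : sphere_cont (res q) by exact: sphere_cont_restrict.
pose q := (c * (eta / 2)) *: linform (val r) ^+ N.*2 + (c / 2) *: linform (val r) ^+ N.*2.+1
  - mpolyC m.+1 (c * (eta ^+ 2) ^+ N).
have qE p : res q p = c * ((t p ^+ 2) ^+ N * (eta + t p) / 2 - (eta ^+ 2) ^+ N).
  rewrite restrictB restrictD !restrictZ restrictC !restrictX res_linform -/(t p).
  by rewrite exprS -mul2n exprM; ring.
have mq : mean (res q) <= mean v by apply: mean_le => // p; rewrite qE.
have mqE : mean (res q) = c * (eta / 2 * a N) - c * (eta ^+ 2) ^+ N.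
  rewrite (_ : res q = fun p => ((c * (eta / 2)) * res (linform (val r) ^+ N.*2) p +
     (c / 2) * res (linform (val r) ^+ N.*2.+1) p) + (-1) * (c * (eta ^+ 2) ^+ N)); last first.
    by apply/funext => p; rewrite restrictB restrictD !restrictZ restrictC mulN1r.
  have c1 := sphere_contZ (c := c * (eta / 2)) (cr (linform (val r) ^+ N.*2)).
  have c2 := sphere_contZ (c := c / 2) (cr (linform (val r) ^+ N.*2.+1)).
  rewrite mean_lin ?mean_cst; [|exact: sphere_contD|exact: sphere_cont_cst].
  by rewrite mean_lin ?meanZ// moment_odd -/(a N); ring.
have : 0 < mean (res q) by rewrite mqE -mulrBr mulr_gt0// subr_gt0.
by rewrite -mv ltNge mq.
Qed.

(** * Completeness and projection onto harmonic polynomials *)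

(** Such an [f] is orthogonal to all polynomials; approximating one factor of [f * f] by polynomials
    shows that the square has mean 0, and the mean is strictly positive. *)
Lemma orthogonal_all f : sphere_cont f ->
  (forall k q, harm_poly R m k q -> mean (fun p => f p * res q p) = 0) -> forall p, f p = 0.
Proof.
move=> cf orth.
have orthq q : mean (fun p => f p * res q p) = 0.
  have [h [N [Hh qE]]] := restrict_hexp q.
  have -> : (fun p => f p * res q p) = fun p => \sum_(k < N) f p * res (h k) p.
    by apply/funext => p; rewrite qE /hsum [LHS]mulr_sumr.
  rewrite mean_sum => [|k]; last exact: (sphere_contM cf (@sphere_cont_restrict R m _)).
  by rewrite big1// => k _; apply: orth (Hh.1 k).
have [B B0 HB] := sphere_bound cf.
have cff := sphere_contM cf cf.
have m0 : mean (fun p => f p * f p) = 0.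
  apply/eqP; rewrite -normr_le0; apply/ler_addgt0Pr => e e0; rewrite add0r.
  have [q Hq] := sphere_weierstrass cf (divr_gt0 e0 B0).
  have cfq := sphere_contM cf (@sphere_cont_restrict R m q).
  have : `|mean (fun p => f p * f p + (-1) * (f p * res q p))| <= e.
    apply: mean_norm_le => p.
    have -> : f p * f p + -1 * (f p * res q p) = f p * (f p - res q p).
      by move: (f p) (res q p) => *; ring.
    have eB : e = B * (e / B) by rewrite mulrCA mulfV ?mulr1// gt_eqF.
    by rewrite normrM [leRHS]eB; apply: ler_pM.
  by rewrite mean_lin// orthq mulr0 addr0.
move=> p; have ff0 r : 0 <= f r * f r by rewrite -expr2 sqr_ge0.
by have /eqP := mean_eq0 cff ff0 m0 p; rewrite mulf_eq0 orbb => /eqP.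
Qed.

(* Gram-Schmidt, where membership of [v] in the span of [s] is replaced by orthogonality to
   whatever is orthogonal to [s]. *)
Lemma projection (k : nat) (s : seq (mpoly m.+1 R)) : {in s, forall b, b \is homog k} ->
  forall f, sphere_cont f -> exists v, [/\ v \is homog k,
    {in s, forall b, mean (fun p => (f p - res v p) * res b p) = 0} &
    forall g, sphere_cont g -> {in s, forall b, mean (fun p => g p * res b p) = 0} ->
      mean (fun p => g p * res v p) = 0].
Proof.
have cr (q : mpoly m.+1 R) : sphere_cont (res q) by exact: sphere_cont_restrict.
have lin g q1 q2 c : sphere_cont g -> mean (fun p => g p * res (q1 + c *: q2) p) =
    mean (fun p => g p * res q1 p) + c * mean (fun p => g p * res q2 p).
  move=> cg; rewrite -(mean_lin c (sphere_contM cg (cr q1)) (sphere_contM cg (cr q2))).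
  by congr mean; apply/funext => p; rewrite restrictD restrictZ mulrDr mulrCA.
have linf f q1 q2 (b : mpoly m.+1 R) c : sphere_cont f ->
    mean (fun p => (f p - res (q1 + c *: q2) p) * res b p) =
    mean (fun p => (f p - res q1 p) * res b p) - c * mean (fun p => res q2 p * res b p).
  move=> cf.
  have c1 : sphere_cont (fun p => (f p - res q1 p) * res b p).
    apply: sphere_contM (cr b).
    have := sphere_contD cf (sphere_contZ (c := -1) (cr q1)).
    by congr sphere_cont; apply/funext => p; rewrite mulN1r.
  rewrite -mulNr -(mean_lin (- c) c1 (sphere_contM (cr q2) (cr b))).
  congr mean; apply/funext => p; rewrite restrictD restrictZ.
  by move: (f p) (res q1 p) (res q2 p) (res b p) => *; ring.
have csub f v : sphere_cont f -> sphere_cont (fun p => f p - res v p).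
  move=> cf; have := sphere_contD cf (sphere_contZ (c := -1) (cr v)).
  by congr sphere_cont; apply/funext => p; rewrite mulN1r.
elim: s => [|b s IH] sk f cf.
  exists 0; split=> //; first exact: dhomog0.
  move=> g cg _; rewrite -[RHS]mean_cst; congr mean; apply/funext => p.
  by rewrite (_ : res 0 p = 0) ?mulr0//; exact: meval0.
have sk' : {in s, forall b, b \is homog k} by move=> x xs; apply: sk; rewrite inE xs orbT.
have bk : b \is homog k by apply: sk; rewrite mem_head.
have [v [vk vo vs]] := IH sk' f cf.
have [w [wk wo ws]] := IH sk' (res b) (cr b).
(* The part of [b] orthogonal to [s]; the projection [v] is corrected along it. *)
pose e := b + (-1) *: w.
have ek : e \is homog k by apply: homogD => //; exact: homogZ.
have eE p : res e p = res b p - res w p by rewrite restrictD restrictZ mulN1r.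
have eo : {in s, forall c, mean (fun p => res e p * res c p) = 0}.
  move=> c cs; rewrite -(wo c cs); congr mean; apply/funext => p; by rewrite eE.
have eb : mean (fun p => res e p * res b p) = mean (fun p => res e p * res e p).
  by rewrite [in RHS]/e (lin _ _ _ _ (cr e)) (ws _ (cr e) eo) mulr0 addr0.
pose A := mean (fun p => (f p - res v p) * res b p).
pose C := mean (fun p => res e p * res e p).
exists (v + (A / C) *: e); split.
- by apply: homogD => //; exact: homogZ.
- move=> c; rewrite inE => /orP[/eqP ->|cs]; rewrite linf//; last first.
    by rewrite vo// eo// mulr0 subr0.
  rewrite eb -/A -/C.
  (* If [C = 0], then [e] vanishes on the sphere, so [b] agrees there with [w], to which [f - v] is
     already orthogonal. *)
  have [C0|C0] := eqVneq C 0; last by rewrite divfK// subrr.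
  rewrite C0 mulr0 subr0.
  have e0 p : res e p * res e p = 0.
    by apply: (mean_eq0 (sphere_contM (cr e) (cr e))) => // r; rewrite -expr2 sqr_ge0.
  have cfv := csub f v cf.
  have <- : A + (-1) * mean (fun p => (f p - res v p) * res w p) = 0.
    rewrite /A -(lin _ _ _ _ cfv) -[RHS]mean_cst; congr mean; apply/funext => p.
    by have /eqP := e0 p; rewrite mulf_eq0 orbb => /eqP ->; rewrite mulr0.
  by rewrite ws// mulr0 addr0.
- move=> g cg gs; rewrite lin//.
  have gs' : {in s, forall b, mean (fun p => g p * res b p) = 0}.
    by move=> x xs; apply: gs; rewrite inE xs orbT.
  rewrite vs// add0r /e lin// ws// mulr0 addr0 gs ?mulr0//.
  by rewrite mem_head.
Qed.

Lemma homog_projection k f : sphere_cont f ->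
  exists2 v, v \is homog k & forall w, w \is homog k ->
    mean (fun p => (f p - res v p) * res w p) = 0.
Proof.
move=> cf.
(* The monomials of degree [k], selected from the finite type of exponents of degree less than
   [k.+1]. *)
pose s := [seq mpolyX R (bmnm b) | b <- index_enum (bmultinom m.+1 k.+1) & mdeg (bmnm b) == k].
have sk : {in s, forall b, b \is homog k}.
  move=> _ /mapP[b + ->]; rewrite mem_filter => /andP[bk _].
  by rewrite dhomogX.
have [v [vk vo _]] := projection sk cf.
exists v => // w /dhomogP wk.
have cfv : sphere_cont (fun p => f p - res v p).
  have := sphere_contD cf (sphere_contZ (c := -1) (@sphere_cont_restrict R m v)).
  by congr sphere_cont; apply/funext => p; rewrite mulN1r.
pose T (j : multinom m.+1) p := mcoeff j w * ((f p - res v p) * res (mpolyX R j) p).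
have cT j : sphere_cont (fun p => (f p - res v p) * res (mpolyX R j) p).
  exact: (sphere_contM cfv (@sphere_cont_restrict R m _)).
have -> : (fun p => (f p - res v p) * res w p) = fun p => \sum_(j <- msupp w) T j p.
  apply/funext => p; rewrite {1}(mpolyE w) -[res (\sum_(_ <- _) _) p]/(pev _ (val p)) pev_sum.
  rewrite [LHS]mulr_sumr; apply: eq_bigr => j _.
  by rewrite pevZ mulrCA.
rewrite mean_sum => [|j]; last exact: (sphere_contZ (cT j)).
rewrite big_seq big1// => j /wk E; have {}E : mdeg j = k := E.
rewrite meanZ// vo ?mulr0//.
have jk : (mdeg j < k.+1)%N by rewrite E.
apply/mapP; exists (BMultinom jk) => //.
by rewrite mem_filter mem_index_enum andbT; apply/eqP.
Qed.

(** The projection [v] on homogeneous polynomials splits as [h + sqn * r]. On the sphere the second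
    part is a sum of harmonics of lower degree, orthogonal to degree [k], so [h] and [v] have the
    same products with harmonics of degree [k]. *)
Lemma harm_projection k f : sphere_cont f -> exists h, [/\ harm_poly R m k h,
  sphere_cont (fun p => f p - res h p),
  forall q, harm_poly R m k q -> mean (fun p => (f p - res h p) * res q p) = 0 &
  forall j q, j != k -> harm_poly R m j q ->
    mean (fun p => (f p - res h p) * res q p) = mean (fun p => f p * res q p)].
Proof.
move=> cf; have [v vk vo] := homog_projection k cf.
have cr (q : mpoly m.+1 R) : sphere_cont (res q) by exact: sphere_cont_restrict.
have sub_lin h q g : sphere_cont g -> mean (fun p => (g p - res h p) * res q p) =
    mean (fun p => g p * res q p) - mean (fun p => res h p * res q p).
  move=> cg; rewrite -mulN1r -(mean_lin (-1) (sphere_contM cg (cr q)) (sphere_contM (cr h) (cr q))).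
  congr mean; apply/funext => p; by move: (g p) (res h p) (res q p) => *; ring.
have csub h : sphere_cont (fun p => f p - res h p).
  have := sphere_contD cf (sphere_contZ (c := -1) (cr h)).
  by congr sphere_cont; apply/funext => p; rewrite mulN1r.
have [h hk hv] : exists2 h, harm_poly R m k h &
    forall q, harm_poly R m k q ->
      mean (fun p => res v p * res q p) = mean (fun p => res h p * res q p).
  have [k1|k2] := leqP k 1.
    by exists v => //; apply/harm_polyE; split => //; exact: Lap_homog_le1 vk.
  have [d dE] : exists d, k = d.+2 by exists k.-2; lia.
  subst k; have [h [r [hd hL rd vE]]] := harmonic_split vk.
  exists h => // q qk.
  have [g Hg rE] := homog_hexp rd.
  have -> : (fun p => res v p * res q p) = fun p => res h p * res q p + 1 * (res r p * res q p).
    by apply/funext => p; rewrite vE restrictD restrictM res_sqn mulrDl !mul1r.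
  rewrite (mean_lin 1 (sphere_contM (cr h) (cr q)) (sphere_contM (cr r) (cr q))) mul1r.
  have -> : (fun p => res r p * res q p) = fun p => \sum_(j < d.+1) res (g j) p * res q p.
    by apply/funext => p; rewrite rE /hsum [LHS]mulr_suml.
  rewrite mean_sum => [|j]; last exact: sphere_contM (cr _) (cr _).
  rewrite big1 ?addr0// => j _; apply: harm_orthogonal (Hg.1 j) qk.
  by rewrite ltn_eqF// ltnS ltnW.
exists h; split => //.
- by move=> q qk; rewrite sub_lin// -hv// -sub_lin// vo//; exact: qk.1.
- by move=> j q jk qj; rewrite sub_lin// (harm_orthogonal _ hk qj) ?subr0// eq_sym.
Qed.

Lemma harm_of_orthogonal f k : sphere_cont f ->
  (forall j q, j != k -> harm_poly R m j q -> mean (fun p => f p * res q p) = 0) ->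
  exists2 h, harm_poly R m k h & f = res h.
Proof.
move=> cf orth; have [h [hk ch ok oj]] := harm_projection k cf.
exists h => //; apply/funext => p; apply/eqP; rewrite -subr_eq0; apply/eqP.
apply: (orthogonal_all ch) => j q qj.
by have [jk|jk] := eqVneq j k; [subst j; exact: ok|rewrite (oj j)// (orth j)].
Qed.

(** Subtracting the projection on degree [k] leaves only degree 0, that is, a constant. *)
Lemma harm_cst_of_orthogonal f k : sphere_cont f ->
  (forall j q, j != k -> j != 0%N -> harm_poly R m j q -> mean (fun p => f p * res q p) = 0) ->
  exists h c, harm_poly R m k h /\ f = fun p => res h p + c.
Proof.
move=> cf orth; have [h [hk ch ok oj]] := harm_projection k cf.
have [|g g0 gE] := @harm_of_orthogonal _ 0 ch.
  move=> j q j0 qj; have [jk|jk] := eqVneq j k; first by subst j; exact: ok.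
  by rewrite (oj j)// (orth j).
exists h, (res g (pole R m)); split => //; apply/funext => p.
by rewrite -(res_homog0 p _ g0.1) -gE addrC subrK.
Qed.

(* The real and imaginary parts of the powers of x_0 + i x_1, which are harmonic by the
   Cauchy-Riemann equations. *)
Fixpoint cpow (k : nat) : mpoly m.+1 R * mpoly m.+1 R :=
  if k is k'.+1 then
    let X := mpolyX R (mnm1 ord0) in
    let Y := mpolyX R (mnm1 (inord 1 : 'I_m.+1)) in
    (X * (cpow k').1 - Y * (cpow k').2, X * (cpow k').2 + Y * (cpow k').1)
  else (1, 0).

(** Makes every [lam k] an eigenvalue. At the pole [x_0 + i x_1 = 1], so the real part of each power
    is 1 there; the coordinate [x_1] exists because [m >= 1]. *)
Lemma harm_nonzero k : exists2 q, harm_poly R m k q & res q (pole R m) = 1.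
Proof.
pose o1 : 'I_m.+1 := inord 1.
have o1E : val o1 = 1%N by rewrite /= inordK.
have o01 : ord0 != o1 by rewrite -val_eqE o1E.
have f01 := negPf o01; have f10 : (o1 == ord0) = false by rewrite eq_sym.
have cr_eq : [/\ (cpow k).1 \is homog k, (cpow k).2 \is homog k,
    mderiv ord0 (cpow k).1 = mderiv o1 (cpow k).2,
    mderiv o1 (cpow k).1 = - mderiv ord0 (cpow k).2 &
    forall i, i != ord0 -> i != o1 -> mderiv i (cpow k).1 = 0 /\ mderiv i (cpow k).2 = 0].
  elim: k => [|k [h1 h2 d0 d1 di]] /=.
    have D1 i : mderiv i (1 : mpoly m.+1 R) = 0 by rewrite -mpolyC1 mderivC.
    split; rewrite ?dhomog1 ?dhomog0// ?D1 ?raddf0 ?oppr0// => i _ _.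
    by rewrite D1 raddf0.
  have hm' (i : 'I_m.+1) (q : mpoly m.+1 R) : q \is homog k -> mpolyX R (mnm1 i) * q \is homog k.+1.
    by move=> qk; exact: (dhomogM (homog_var R i) qk).
  have v00 : mderiv ord0 (mpolyX R (@mnm1 m.+1 ord0)) = 1 by rewrite mderiv_var eqxx.
  have v11 : mderiv o1 (mpolyX R (mnm1 o1)) = 1 by rewrite mderiv_var eqxx.
  have v01 : mderiv ord0 (mpolyX R (mnm1 o1)) = 0 by rewrite mderiv_var f01.
  have v10 : mderiv o1 (mpolyX R (@mnm1 m.+1 ord0)) = 0 by rewrite mderiv_var f10.
  split.
  - by rewrite -scaleN1r; apply: homogD; [exact: hm'|apply: homogZ; exact: hm'].
  - by apply: homogD; exact: hm'.
  - by rewrite mderivB mderivD !mderivM -/o1 v00 v01 v10 v11 d0 d1; ring.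
  - by rewrite mderivB mderivD !mderivM -/o1 v00 v01 v10 v11 d0 d1; ring.
  - move=> i i0 i1; have [e1 e2] := di i i0 i1.
    have w0 : mderiv i (mpolyX R (@mnm1 m.+1 ord0)) = 0 by rewrite mderiv_var (negPf i0).
    have w1 : mderiv i (mpolyX R (mnm1 o1)) = 0 by rewrite mderiv_var (negPf i1).
    by rewrite mderivB mderivD !mderivM -/o1 w0 w1 e1 e2 !mulr0 !mul0r !addr0 subr0.
have [h1 h2 d0 d1 di] := cr_eq.
exists (cpow k).1.
  apply/harm_polyE; split => //; rewrite /Lap (bigD1 ord0)//= (bigD1 o1)/=; last by rewrite eq_sym.
  rewrite big1 => [|i /andP[i0 i1]]; last by rewrite (di i i0 i1).1 raddf0.
  (* The two remaining second derivatives are mixed derivatives of the imaginary part with opposite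
     signs. *)
  by rewrite d0 d1 raddfN/= mderiv_comm addr0 subrr.
have P0 : val (pole R m) 0 ord0 = 1 by rewrite /= mxE !eqxx.
have P1 : val (pole R m) 0 o1 = 0 by rewrite /= mxE eq_sym (negPf o01) andbF.
suff [//] : res (cpow k).1 (pole R m) = 1 /\ res (cpow k).2 (pole R m) = 0.
elim: (k) => [|j [IH1 IH2]] /=; first by split; [exact: meval1|exact: meval0].
rewrite restrictB restrictD !restrictM IH1 IH2.
rewrite -![res (mpolyX R _) _]/(pev _ (val (pole R m))) !pevX P0 P1; split; ring.
Qed.

End mean.

(** * The spectra *)

Section spectra.
Variables (R : realType) (m : nat) (hm : (1 <= m)%N).
Implicit Types (p : usphere R m) (f : usphere R m -> R).
Local Notation lam := (lambda R m).
Local Notation res := (@restrict_sphere R m).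

Lemma slap_harmE k h : harm_poly R m k h -> slap (res h) = fun p => - lam k * res h p.
Proof. by move=> hk; apply/funext => p; exact: slap_harm. Qed.

Lemma bilap_harmE k h : harm_poly R m k h -> bilap (res h) = fun p => lam k ^+ 2 * res h p.
Proof.
move=> hk; apply/funext => p; rewrite /bilap (slap_harmE hk).
rewrite slapZ; last exact: smooth_ext_restrict.
by rewrite (slap_harm _ hk) mulrA mulrNN expr2.
Qed.

Lemma smooth_restrict h : smooth_sphere (res h).
Proof. exact/smooth_sphereP/smooth_ext_restrict. Qed.

Lemma harm_nontrivial k : exists2 h, harm_poly R m k h & res h <> cst 0.
Proof.
have [h hk h1] := harm_nonzero R hm k; exists h => // h0.
by move: h1; rewrite h0 => /esym/eqP; rewrite oner_eq0.
Qed.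

Lemma nontrivial_coefficient f : smooth_sphere f -> f <> cst 0 ->
  exists k q, harm_poly R m k q /\ mean (fun p => f p * res q p) != 0.
Proof.
move=> /smooth_sphereP sf f0; apply: contrapT => H; apply: f0; apply/funext => p.
apply: (orthogonal_all hm (smooth_ext_cont sf)) => k q qk.
by apply/eqP; apply: contrapT => /negP H'; apply: H; exists k, q.
Qed.

(** Pairing the equation with degree [k]: a nonzero coefficient forces [l = lam k]. The bi-Laplacian
    and buckling equations are treated in the same way. *)
Lemma mean_eigen f l k q : smooth_sphere f -> slap f = (fun p => - l * f p) ->
  harm_poly R m k q -> (lam k - l) * mean (fun p => f p * res q p) = 0.
Proof.
move=> /smooth_sphereP sf fl qk; have := mean_slap_harm hm sf qk.
have cfq := sphere_contM (smooth_ext_cont sf) (@sphere_cont_restrict R m q).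
have -> : (fun p => slap f p * res q p) = fun p => - l * (f p * res q p).
  by apply/funext => p; rewrite fl mulrA.
by rewrite (meanZ hm)// => E; rewrite mulrBl -[lam k * _]opprK -mulNr -E; ring.
Qed.

Lemma mean_bilap f k q : smooth_sphere f -> harm_poly R m k q ->
  mean (fun p => bilap f p * res q p) = lam k ^+ 2 * mean (fun p => f p * res q p).
Proof.
move=> /smooth_sphereP sf qk.
by rewrite (mean_slap_harm hm (slap_ext sf) qk) (mean_slap_harm hm sf qk) mulrA mulrNN expr2.
Qed.

Lemma mean_bi_eigen f mu k q : bilap_space R m mu f -> harm_poly R m k q ->
  (lam k ^+ 2 - mu) * mean (fun p => f p * res q p) = 0.
Proof.
move=> [sf fmu] qk; have := mean_bilap sf qk; rewrite fmu.
move/smooth_sphereP : (sf) => /smooth_ext_cont cf.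
have cfq := sphere_contM cf (@sphere_cont_restrict R m q).
have -> : (fun p => mu * f p * res q p) = fun p => mu * (f p * res q p).
  by apply/funext => p; rewrite mulrA.
by rewrite (meanZ hm)// => E; rewrite mulrBl E subrr.
Qed.

Lemma mean_buckling f nu k q : buckling_space R m nu f -> harm_poly R m k q ->
  lam k * (lam k - nu) * mean (fun p => f p * res q p) = 0.
Proof.
move=> [sf fnu] qk; have := mean_bilap sf qk; rewrite fnu.
move/smooth_sphereP : (sf) => sf'.
have cfq := sphere_contM (smooth_ext_cont (slap_ext sf')) (@sphere_cont_restrict R m q).
have -> : (fun p => - nu * slap f p * res q p) = fun p => - nu * (slap f p * res q p).
  by apply/funext => p; rewrite mulrA.
rewrite (meanZ hm)// (mean_slap_harm hm sf' qk) mulrA mulrNN.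
by move=> E; rewrite mulrBr mulrBl -expr2 -E; ring.
Qed.

Lemma lap_spectrumE : lap_spectrum R m = [set lam k | k in [set: nat]].
Proof.
apply/seteqP; split => [l [f [sf f0 fl]]|_ [k _ <-]].
  have [k [q [qk M0]]] := nontrivial_coefficient sf f0.
  exists k => //; have /eqP := mean_eigen sf fl qk.
  by rewrite mulf_eq0 (negPf M0) orbF subr_eq0 => /eqP.
have [h hk h0] := harm_nontrivial k.
by exists (res h); split => //; [exact: smooth_restrict|exact: slap_harmE].
Qed.

Lemma bilap_spectrumE : bilap_spectrum R m = [set lam k ^+ 2 | k in [set: nat]].
Proof.
apply/seteqP; split => [mu [f [fmu f0]]|_ [k _ <-]].
  have [k [q [qk M0]]] := nontrivial_coefficient fmu.1 f0.
  exists k => //; have /eqP := mean_bi_eigen fmu qk.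
  by rewrite mulf_eq0 (negPf M0) orbF subr_eq0 => /eqP.
have [h hk h0] := harm_nontrivial k.
by exists (res h); split => //; split; [exact: smooth_restrict|exact: bilap_harmE].
Qed.

Lemma bilap_spaceE k : bilap_space R m (lam k ^+ 2) = [set res h | h in harm_poly R m k].
Proof.
apply/seteqP; split => [f fk|_ [h hk <-]]; last first.
  by split; [exact: smooth_restrict|exact: bilap_harmE].
have /smooth_sphereP/smooth_ext_cont cf := fk.1.
have [|h hk ->] := @harm_of_orthogonal R m hm f k cf; last by exists h.
move=> j q jk qj; have /eqP := mean_bi_eigen fk qj; rewrite mulf_eq0 => /orP[|/eqP//].
rewrite subr_eq0 eqrXn2// ?lambda_ge0// => /eqP /(lambda_inj hm) E.
by rewrite E eqxx in jk.
Qed.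

(** The coefficient of degree [j] is annihilated by [lam j * (lam j - nu)], so only degree 0 can
    survive, together with the degree [k] for which [nu = lam k], if there is one. *)
Lemma buckling_classification nu f : buckling_space R m nu f ->
  (exists c, f = cst c) \/
  exists k h c, [/\ nu = lam k, harm_poly R m k h & f = fun p => res h p + c].
Proof.
move=> fnu; have /smooth_sphereP/smooth_ext_cont cf := fnu.1.
have orth j q : harm_poly R m j q -> j != 0%N -> nu != lam j ->
    mean (fun p => f p * res q p) = 0.
  move=> qj j0 nj; have lj : 0 < lam j by apply: (lambda_gt0 R hm); rewrite lt0n.
  have /eqP := mean_buckling fnu qj; rewrite mulf_eq0 => /orP[|/eqP//].
  by rewrite mulf_eq0 (gt_eqF lj)/= subr_eq0 eq_sym (negPf nj).
have [[k nk]|nok] := pselect (exists k, nu = lam k); last first.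
  left; have [|g g0 gE] := @harm_of_orthogonal R m hm f 0 cf.
    by move=> j q j0 qj; apply: orth qj j0 _; apply/eqP => E; apply: nok; exists j.
  exists (res g (pole R m)); rewrite gE; apply/funext => p; exact: res_homog0 g0.1.
right; have [|h [c [hk fE]]] := @harm_cst_of_orthogonal R m hm f k cf.
  move=> j q jk j0 qj; apply: orth qj j0 _; rewrite nk; apply: contra jk => /eqP/(lambda_inj hm) ->.
  exact: eqxx.
by exists k, h, c.
Qed.

Lemma res_sqnorm h c p : res (h + c *: sqnorm_poly R m) p = res h p + c.
Proof. by rewrite restrictD restrictZ [res (sqnorm_poly R m) p]res_sqn mulr1. Qed.

Lemma buckling_harm k h c : harm_poly R m k h ->
  buckling_space R m (lam k) (fun p => res h p + c).
Proof.
move=> hk; have sh := smooth_ext_restrict h.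
have sc : smooth_ext (cst c : usphere R m -> R) by exact: smooth_ext_cst.
have E : slap (fun p => res h p + c) = fun p => - lam k * res h p.
  apply/funext => p; have := slapD p sh sc; rewrite slap_cst addr0 (slap_harm _ hk) => <-.
  by congr (slap _ p).
split; first exact/smooth_sphereP/smooth_extD.
by apply/funext => p; rewrite /bilap E slapZ// (slap_harm _ hk).
Qed.

Lemma buckling_spaceE k : buckling_space R m (lam k) =
  [set f | exists h c, harm_poly R m k h /\ f = res (h + c *: sqnorm_poly R m)].
Proof.
apply/seteqP; split => [f fk|_ [h [c [hk ->]]]]; last first.
  have := buckling_harm c hk; congr buckling_space.
  by apply/funext => p; rewrite res_sqnorm.
have [[c ->]|[j [h [c [jk hj ->]]]]] := buckling_classification fk.
  exists 0, c; split; first exact: harm0.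
  by apply/funext => p; rewrite res_sqnorm [res 0 p](_ : _ = 0) ?add0r//; exact: meval0.
have {jk} jk := lambda_inj hm jk; subst j.
by exists h, c; split => //; apply/funext => p; rewrite res_sqnorm.
Qed.

Lemma buckling_spectrumE : buckling_spectrum R m = [set lam k | k in [set: nat]].
Proof.
apply/seteqP; split => [nu [->|[f [fnu fc]]]|_ [k _ <-]].
- by exists 0%N => //; exact: lambda0.
- by have [//|[k [h [c [-> _ _]]]]] := buckling_classification fnu; exists k.
(* Degree 0 gives only constant functions; [lam 0 = 0] is the trivial buckling eigenvalue, adjoined
   by definition. *)
have [->|k0] := posnP k; first by left; exact: lambda0.
right; have [h hk h0] := harm_nontrivial k.
exists (res h); split; first by split; [exact: smooth_restrict|
  rewrite (bilap_harmE hk) (slap_harmE hk); apply/funext => p; rewrite mulrA mulrNN expr2].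
(* Were [res h] a constant [c], its Laplacian would be 0, and [lam k > 0] would give [c = 0]. *)
move=> [c hc]; apply: h0; apply/funext => p; have := slap_harm p hk.
rewrite hc slap_cst => /esym/eqP; rewrite mulf_eq0 oppr_eq0 gt_eqF ?lambda_gt0//=.
by move=> /eqP.
Qed.

Lemma lambda1 : lam 1 = m%:R.
Proof. by rewrite /lambda; ring. Qed.

Lemma lambda_ge_first k : lam k != 0 -> m%:R <= lam k.
Proof.
case: k => [|[|k]]; rewrite ?lambda0 ?eqxx// -lambda1// => _.
by rewrite ltW// lambda_lt.
Qed.

End spectra.

Theorem theorem2p6 (R : realType) (m : nat) (hm : (1 <= m)%N) :
  [/\ bilap_spectrum R m = [set lambda R m k ^+ 2 | k in [set: nat]],
      bilap_spectrum R m = [set l ^+ 2 | l in lap_spectrum R m],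
      (forall k : nat,
         bilap_space R m (lambda R m k ^+ 2) =
         [set restrict_sphere h | h in harm_poly R m k]) &
      first_nonzero (bilap_spectrum R m) (m%:R ^+ 2)] /\
  [/\ buckling_spectrum R m = lap_spectrum R m,
      lap_spectrum R m = [set lambda R m k | k in [set: nat]],
      (forall k : nat,
         buckling_space R m (lambda R m k) =
         [set f | exists (h : mpoly m.+1 R) (c : R),
            harm_poly R m k h /\
            f = restrict_sphere (h + c *: sqnorm_poly R m)]) &
      first_nonzero (buckling_spectrum R m) m%:R].
Proof.
have mN0 : m%:R != 0 :> R by rewrite pnatr_eq0 -lt0n.
rewrite buckling_spectrumE// bilap_spectrumE// lap_spectrumE//.
split; split => //.
- apply/seteqP; split => [_ [k _ <-]|_ [_ [k _ <-] <-]]; last by exists k.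
  by exists (lambda R m k) => //; exists k.
- exact: bilap_spaceE.
- split; [by exists 1%N => //; rewrite lambda1|by rewrite expf_neq0|].
  move=> _ [k _ <-]; rewrite expf_eq0/= => l0.
  by rewrite lerXn2r ?nnegrE ?lambda_ge0// lambda_ge_first.
- exact: buckling_spaceE.
- split; [by exists 1%N => //; rewrite lambda1|by []|].
  by move=> _ [k _ <-]; exact: lambda_ge_first.
Qed.
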